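(* Let $n\ge 3$ and let $$C^{>}=\Bigl\{x+iy\in\mathbb{C}^{n+1}: x_{n+1}>x_1x_2+x_1\sum_{j=3}^n x_j^2,\ x_1>0\Bigr\},\qquad C^{<}=\Bigl\{x+iy\in\mathbb{C}^{n+1}: x_{n+1}<x_1x_2+x_1\sum_{j=3}^n x_j^2,\ x_1>0\Bigr\}.$$ Then neither of the two domains $C^{>}$, $C^{<}$ is equivalent to a nil-ball.
   Context: Here $x,y\in\mathbb{R}^{n+1}$. Equivalent means biholomorphically equivalent. Both domains have the hypersurface $\tilde\Gamma=\{x+iy: x_{n+1}=x_1x_2+x_1\sum_{j=3}^n x_j^2,\ x_1>0\}$ in their boundary, and $\tilde\Gamma$ is Levi non-degenerate of signature $(n-1,1)$. Nil-balls (also called Siegel domains of type N-P) are the homogeneous domains introduced by R. Penney as a generalization of homogeneous Siegel domains; the paper uses them only through the following property known from Penney's work: if $C^{>}$ (respectively $C^{<}$) is equivalent to a nil-ball, then a nilpotent Lie group contained in the group of holomorphic automorphisms of $C^{>}$ (respectively $C^{<}$), whose elements extend holomorphically across $\tilde\Gamma$, acts transitively on $\tilde\Gamma$. For the present statement, this property may be taken as what ''equivalent to a nil-ball'' entails. *)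

(* Defs.v *)
From HB Require Import structures.
From mathcomp Require Import all_boot all_order all_algebra.
From mathcomp Require Import complex.
From mathcomp Require Import all_classical all_reals all_analysis.

Set Implicit Arguments.
Unset Strict Implicit.
Unset Printing Implicit Defensive.

Import Order.TTheory GRing.Theory Num.Theory.
Import numFieldNormedType.Exports.

Local Open Scope classical_set_scope.
Local Open Scope ring_scope.

(* R[i] with the topology and normed structure of its modulus. *)
HB.instance Definition _ (R : rcfType) :=
  PseudoPointedMetric.copy R[i] R[i]^o.
HB.instance Definition _ (R : rcfType) := GRing.ComAlgebra.copy R[i] R[i]^o.
HB.instance Definition _ (R : rcfType) := Vector.copy R[i] R[i]^o.
HB.instance Definition _ (R : rcfType) := NormedModule.copy R[i] R[i]^o.

(* [C^k] on an open subset of a finite-dimensional real normed space, through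
   iterated directional derivatives; not intended for infinite dimension. *)
Fixpoint class_C (R : realType) (V W : normedModType R) (k : nat)
    (U : set V) (f : V -> W) : Prop :=
  match k with
  | 0 => forall x, U x -> {for x, continuous f}
  | k'.+1 => (forall x, U x -> differentiable f x) /\
             (forall v : V, class_C k' U ('D_v f))
  end.

Definition smooth_on (R : realType) (V W : normedModType R) (U : set V)
    (f : V -> W) : Prop := forall k, class_C k U f.

(* [chart_map] and [chart_inv] are total functions; only their restrictions to
   [chart_dom] and [chart_cod] matter. *)
Record chart (R : realType) (T : topologicalType) (d : nat) := Chart {
  chart_dom : set T;
  chart_cod : set 'rV[R]_d;
  chart_map : T -> 'rV[R]_d;
  chart_inv : 'rV[R]_d -> T;
  chart_dom_open : open chart_dom;
  chart_cod_open : open chart_cod;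
  chart_map_cod : forall x, chart_dom x -> chart_cod (chart_map x);
  chart_inv_dom : forall u, chart_cod u -> chart_dom (chart_inv u);
  chart_mapK : forall x, chart_dom x -> chart_inv (chart_map x) = x;
  chart_invK : forall u, chart_cod u -> chart_map (chart_inv u) = u;
  chart_map_continuous :
    forall x, chart_dom x -> {for x, continuous chart_map};
  chart_inv_continuous :
    forall u, chart_cod u -> {for u, continuous chart_inv}
}.

HB.mixin Record isTopologicalGroup G of Group G & Topological G := {
  mulg_continuous : continuous (fun x : G * G => (x.1 * x.2)%g);
  invg_continuous : continuous (fun x : G => (x^-1)%g)
}.

#[short(type="topGroupType")]
HB.structure Definition TopologicalGroup :=
  {G of Group G & Topological G & isTopologicalGroup G}.

HB.mixin Record isLieGroup (R : realType) G of TopologicalGroup G := {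
  lie_hausdorff : hausdorff_space G;
  lie_second_countable : @second_countable G;
  lie_dim : nat;
  lie_atlas : set (chart R G lie_dim);
  lie_atlas_cover : forall x : G, exists2 c, lie_atlas c & chart_dom c x;
  lie_atlas_compatible : forall a b, lie_atlas a -> lie_atlas b ->
    smooth_on [set u | chart_cod a u /\ chart_dom b (chart_inv a u)]
      (fun u => chart_map b (chart_inv a u));
  lie_mul_smooth : forall a b c,
    lie_atlas a -> lie_atlas b -> lie_atlas c ->
    smooth_on
      [set u : 'rV[R]_lie_dim * 'rV[R]_lie_dim |
         [/\ chart_cod a u.1, chart_cod b u.2
           & chart_dom c (chart_inv a u.1 * chart_inv b u.2)%g]]
      (fun u => chart_map c (chart_inv a u.1 * chart_inv b u.2)%g);
  lie_inv_smooth : forall a b, lie_atlas a -> lie_atlas b ->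
    smooth_on [set u | chart_cod a u /\ chart_dom b ((chart_inv a u)^-1)%g]
      (fun u => chart_map b ((chart_inv a u)^-1)%g)
}.

#[short(type="lieGroupType")]
HB.structure Definition LieGroup (R : realType) :=
  {G of TopologicalGroup G & isLieGroup R G}.

Definition is_subgroup (G : groupType) (H : set G) : Prop :=
  H 1%g /\ forall x y, H x -> H y -> H (x * y^-1)%g.

Fixpoint lower_central (G : groupType) (k : nat) : set G :=
  match k with
  | 0 => [set: G]
  | k'.+1 => smallest (@is_subgroup G)
      [set z | exists x y : G, @lower_central G k' x /\ z = [~ x, y]%g]
  end.

Definition nilpotent_group (G : groupType) : Prop :=
  exists k, @lower_central G k = [set 1%g].

(* [differentiable] is Frechet differentiability over the scalar field R[i],
   hence complex differentiability. *)
Definition holomorphic (R : realType) (m k : nat) (U : set 'rV[R[i]]_m)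
    (f : 'rV[R[i]]_m -> 'rV[R[i]]_k) : Prop :=
  open U /\ forall z, U z -> differentiable f z.

Definition biholomorphism (R : realType) (m k : nat)
    (D : set 'rV[R[i]]_m) (E : set 'rV[R[i]]_k)
    (f : 'rV[R[i]]_m -> 'rV[R[i]]_k) : Prop :=
  exists g : 'rV[R[i]]_k -> 'rV[R[i]]_m,
    [/\ holomorphic D f, holomorphic E g,
        forall z, D z -> E (f z) /\ g (f z) = z
      & forall w, E w -> D (g w) /\ f (g w) = w].

Definition biholomorphic (R : realType) (m k : nat)
    (D : set 'rV[R[i]]_m) (E : set 'rV[R[i]]_k) : Prop :=
  exists f, biholomorphism D E f.

(* The Lie group G is contained in Aut(D), via the injective homomorphism act;
   joint continuity of the action is continuity of this inclusion for the
   compact-open topology on Aut(D). *)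
Definition lie_group_of_automorphisms (R : realType) (m : nat)
    (D : set 'rV[R[i]]_m) (G : lieGroupType R)
    (act : G -> 'rV[R[i]]_m -> 'rV[R[i]]_m) : Prop :=
  [/\ forall g, biholomorphism D D (act g),
      forall g h z, D z -> act (g * h)%g z = act g (act h z),
      forall g, (forall z, D z -> act g z = z) -> g = 1%g
    & forall g z, D z ->
        {for (g, z), continuous (fun p : G * 'rV[R[i]]_m => act p.1 p.2)}].

Definition extends_across (R : realType) (m : nat)
    (D S : set 'rV[R[i]]_m) (f F : 'rV[R[i]]_m -> 'rV[R[i]]_m) : Prop :=
  exists U : set 'rV[R[i]]_m,
    [/\ S `<=` U, holomorphic U F & forall z, U z -> D z -> F z = f z].

(* For S contained in the closure of D, the values of ext g on S are determined
   by act g, so that ext restricts to an action of G on S. *)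
Definition boundary_nilpotently_homogeneous (R : realType) (m : nat)
    (D S : set 'rV[R[i]]_m) : Prop :=
  exists (G : lieGroupType R) (act ext : G -> 'rV[R[i]]_m -> 'rV[R[i]]_m),
    [/\ nilpotent_group G,
        lie_group_of_automorphisms D act,
        forall g, extends_across D S (act g) (ext g),
        forall g z, S z -> S (ext g z)
      & forall z w, S z -> S w -> exists g, ext g z = w].

(* The class of nil-balls (Siegel domains of type N-P) is a parameter, given as
   a predicate on subsets of C^m for all m. *)
Definition equivalent_to_nil_ball (R : realType)
    (nil_ball : forall m : nat, set 'rV[R[i]]_m -> Prop) (m : nat)
    (D : set 'rV[R[i]]_m) : Prop :=
  exists (k : nat) (B : set 'rV[R[i]]_k), nil_ball k B /\ biholomorphic D B.

(* Real part of the k-th coordinate, 1 <= k <= n + 1: coordinates are numbered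
   from 1, whereas 'I_n.+1 starts at 0. *)
Definition xcoord (R : realType) (n : nat) (z : 'rV[R[i]]_n.+1) (k : nat) : R :=
  complex.Re (z ord0 (inord k.-1)).

Definition tube_cubic (R : realType) (n : nat) (z : 'rV[R[i]]_n.+1) : R :=
  xcoord z 1 * xcoord z 2
  + xcoord z 1 * \sum_(3 <= j < n.+1) xcoord z j ^+ 2.

Definition Gamma_tilde (R : realType) (n : nat) : set 'rV[R[i]]_n.+1 :=
  [set z | xcoord z n.+1 = tube_cubic z /\ 0 < xcoord z 1].

Definition C_gt (R : realType) (n : nat) : set 'rV[R[i]]_n.+1 :=
  [set z | xcoord z n.+1 > tube_cubic z /\ 0 < xcoord z 1].

Definition C_lt (R : realType) (n : nat) : set 'rV[R[i]]_n.+1 :=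
  [set z | xcoord z n.+1 < tube_cubic z /\ 0 < xcoord z 1].

Arguments Gamma_tilde R n : clear implicits.
Arguments C_gt R n : clear implicits.
Arguments C_lt R n : clear implicits.

(* Main.v *)
Require Import Defs.
From mathcomp Require Import all_boot all_order all_algebra.
From mathcomp Require Import complex.
From mathcomp Require Import all_classical all_reals all_analysis.
From mathcomp Require Import ring lra.

Set Implicit Arguments.
Unset Strict Implicit.
Unset Printing Implicit Defensive.

Import Order.TTheory GRing.Theory Num.Theory.
Import numFieldNormedType.Exports.
Import ComplexField.Normc.

Local Open Scope classical_set_scope.
Local Open Scope ring_scope.

(** The idea is that every automorphism [g] of either domain preserves the
    fibration by the first coordinate, so that a group acting transitively on the
    hypersurface also acts transitively on the right half-plane of that
    coordinate, and that no nilpotent group of holomorphic maps can do this.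

    For the first point, let [f] be the first coordinate of [g], a holomorphic
    function whose real part is positive. Liouville's theorem
    ([entire_right_half_plane]) makes [f] constant on every complex line in the
    domain. Such lines pass through every point, in the direction
    [e_2 + x_1 e_{n+1}]. This direction depends on the real part of [z_1] only,
    which is not holomorphic in [z_1]; comparing real and imaginary increments of
    [z_1] shows that the derivative of [f] along [e_{n+1}] vanishes
    ([diff_last]). As [z_{n+1}] can then be moved freely, [f] extends to an entire
    function on each complex line on which [z_1] is fixed, and Liouville's theorem
    shows that [f] depends on [z_1] only ([depends_on_first]).

    For the second point, let [psi] be the action of an element that commutes with
    a transitive action [phi] on the half-plane. The displacement of [psi] at
    [phi g 1] is the image under [phi g] of its displacement at 1; a weak
    Schwarz-Pick estimate ([half_plane_displacement]) bounds it by a constant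
    multiple of the distance to the boundary. Hence [psi] extends to the boundary
    as the identity, and the maximum principle gives that [psi] fixes 1
    ([bounded_displacement_fix1]), hence every point of its orbit. So commuting
    elements act trivially, and by descending induction along the lower central
    series a nilpotent transitive group would act trivially
    ([transitive_not_nilpotent]).

    Both points rest on the bound of the derivative of a holomorphic map into the
    half-plane ([right_half_plane_bound]). It comes from the maximum principle in
    the form that the value at the centre of a disc is at most the maximum on a
    circle ([center_le_circle]). That is Cauchy's theorem on a rectangle in the
    logarithmic coordinate; holomorphic means differentiable at each point, so
    Cauchy's theorem is proved by Goursat's bisection ([goursat_rectangle]). *)

(** * Modulus and components of complex numbers *)

Section Modulus.
Context {R : realType}.
Local Notation C := R[i].
Implicit Types (z w u : C) (x y e d : R).

Lemma normrE z : `|z| = (normc z)%:C%C.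
Proof. by []. Qed.

Lemma normc_ge0 z : 0 <= normc z.
Proof. by case: z => a b; exact: sqrtr_ge0. Qed.

Lemma normcD_le z w : normc (z + w) <= normc z + normc w.
Proof. exact: le_normcD. Qed.

Lemma normc_opp z : normc (- z) = normc z.
Proof. exact: normcN. Qed.

Lemma normc_distC z w : normc (z - w) = normc (w - z).
Proof. by rewrite -normc_opp opprB. Qed.

Lemma normcB_le z w : normc (z - w) <= normc z + normc w.
Proof. by rewrite -(normc_opp w) normcD_le. Qed.

Lemma normc_gt0 z : (0 < normc z) = (z != 0).
Proof.
rewrite lt_def normc_ge0 andbT; congr (~~ _); apply/eqP/eqP => [/eq0_normc //|->].
exact: normc0.
Qed.

Lemma sqr_normcE z : normc z ^+ 2 = complex.Re z ^+ 2 + complex.Im z ^+ 2.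
Proof. by case: z => a b; rewrite /= sqr_sqrtr // addr_ge0 // sqr_ge0. Qed.

Lemma Re_le_normc z : `|complex.Re z| <= normc z.
Proof.
rewrite -[X in _ <= X]ger0_norm ?normc_ge0 // -ler_sqr ?nnegrE ?normr_ge0 //.
by rewrite !real_normK ?num_real // sqr_normcE lerDl sqr_ge0.
Qed.

Lemma Im_le_normc z : `|complex.Im z| <= normc z.
Proof.
rewrite -[X in _ <= X]ger0_norm ?normc_ge0 // -ler_sqr ?nnegrE ?normr_ge0 //.
by rewrite !real_normK ?num_real // sqr_normcE lerDr sqr_ge0.
Qed.

Lemma normc_le_ReIm z : normc z <= `|complex.Re z| + `|complex.Im z|.
Proof.
rewrite -ler_sqr ?nnegrE ?normc_ge0 ?addr_ge0 // sqr_normcE sqrrD.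
rewrite !real_normK ?num_real //.
by have := mulr_ge0 (normr_ge0 (complex.Re z)) (normr_ge0 (complex.Im z)); lra.
Qed.

Lemma normc_real x : normc x%:C%C = `|x|.
Proof. by rewrite /= expr0n addr0 sqrtr_sqr. Qed.

Lemma Re_mul z w : complex.Re (z * w) =
  complex.Re z * complex.Re w - complex.Im z * complex.Im w.
Proof. by case: z w => a b [c d]. Qed.
Lemma Im_mul z w : complex.Im (z * w) =
  complex.Re z * complex.Im w + complex.Im z * complex.Re w.
Proof. by case: z w => a b [c d]. Qed.
Lemma Re_add z w : complex.Re (z + w) = complex.Re z + complex.Re w.
Proof. by case: z w => a b [c d]. Qed.
Lemma Im_add z w : complex.Im (z + w) = complex.Im z + complex.Im w.
Proof. by case: z w => a b [c d]. Qed.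
Lemma Re_opp z : complex.Re (- z) = - complex.Re z.
Proof. by case: z => a b. Qed.
Lemma Im_opp z : complex.Im (- z) = - complex.Im z.
Proof. by case: z => a b. Qed.
Definition ReImE := (Re_mul, Im_mul, Re_add, Im_add, Re_opp, Im_opp).

Lemma complex_eqP z w : complex.Re z = complex.Re w ->
  complex.Im z = complex.Im w -> z = w.
Proof. by case: z w => a b [c d] /= -> ->. Qed.

(** The balls of [R[i]] have a positive element of [R[i]] as radius, that is, a
    positive real number. *)
Lemma nbhs_normcP (z : C) (P : set C) :
  nbhs z P <-> exists2 d : R, 0 < d & forall w, normc (w - z) < d -> P w.
Proof.
split.
  move=> /(@nbhs_ballP C C) [e /= e0 eP]; exists (complex.Re e).
    by move: e0; rewrite ltcE => /andP[].
  move=> w wz; apply: eP; rewrite -ball_normE /= distrC normrE.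
  move: e0; rewrite !ltcE /= => /andP[/eqP e1 e0].
  by rewrite e1 eqxx.
move=> [d d0 dP]; apply/(@nbhs_ballP C C); exists d%:C%C => /=; first by rewrite ltcR.
move=> w; rewrite -ball_normE /= distrC normrE ltcR.
exact: dP.
Qed.

End Modulus.

(** * Complex derivatives as epsilon-delta estimates *)

Section ComplexDerivative.
Context {R : realType}.
Local Notation C := R[i].
Implicit Types (z w u : C) (x y e d : R) (f g : C -> C).

(** Differentiability over the scalar field [R[i]] with moduli and radii in [R],
    so that it restricts directly to real lines. *)
Definition has_cderiv f z (a : C) := forall e, 0 < e ->
  exists2 d, 0 < d & forall w, normc (w - z) < d ->
    normc (f w - f z - a * (w - z)) <= e * normc (w - z).

Lemma differentiable_has_cderiv f z :
  differentiable f z -> has_cderiv f z (f^`()%classic z).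
Proof.
move=> df e e0.
have := @diff_locally C C C z f df.
rewrite (@diff1E C C f z df) => /eqaddoP /(_ e%:C%C).
rewrite ltcR => /(_ e0) /(@nbhs_normcP R 0) [d d0 dP].
exists d => // w wz; have := dP (w - z); rewrite subr0 => /(_ wz).
rewrite /= !fctE /= subrK opprD addrA -[_ *: _]/(_ * _) [(w - z) * _]mulrC.
by rewrite -lecR rmorphM.
Qed.

Lemma has_cderiv_differentiable f z a : has_cderiv f z a -> differentiable f z.
Proof.
move=> H; apply/(@derivable1_diffP C C f z); apply/cvg_ex; exists a.
apply/(@cvgrPdist_le C C) => e; rewrite ltcE /= => /andP[/eqP e1 e0].
have [d d0 dP] := H _ e0.
rewrite near_withinE; apply/(@nbhs_normcP R 0); exists d => // h.
rewrite subr0 => hd h0.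
have := dP (h + z); rewrite addrK => /(_ hd).
rewrite /= -[h *: 1]/(h * 1) mulr1 -[_^-1 *: _]/(_^-1 * _) => le.
rewrite -[X in X <= _]/((normc (a - h^-1 * (f (h + z) - f z)))%:C%C).
rewrite lecE /= e1 eqxx /= normc_distC.
have -> : h^-1 * (f (h + z) - f z) - a = h^-1 * (f (h + z) - f z - a * h).
  by field.
by rewrite normcM normcV ler_pdivrMl ?normc_gt0 // [leRHS]mulrC.
Qed.

(** A complex derivative is determined by the real increments of the argument
    alone, so that two functions that agree on a real segment only have the same
    derivative there. *)
Lemma real_cderiv_unique f g z a b : has_cderiv f z a -> has_cderiv g z b ->
  (exists2 d, 0 < d & forall t, `|t| < d -> f (z + t%:C%C) = g (z + t%:C%C)) ->
  a = b.
Proof.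
move=> fa gb [d0 d00 fg]; apply/eqP; rewrite -subr_eq0; apply/negP => /negP.
rewrite -normc_gt0 => ab0.
have e0 : 0 < normc (a - b) / 4 by rewrite divr_gt0.
have [d1 d10 H1] := fa _ e0; have [d2 d20 H2] := gb _ e0.
pose d := Num.min d0 (Num.min d1 d2).
have d_gt0 : 0 < d by rewrite !lt_min d00 d10 d20.
pose t := d / 2.
have t0 : 0 < t by rewrite divr_gt0.
have tlt : t < d by rewrite /t; lra.
move: tlt; rewrite !lt_min => /and3P[td0 td1 td2].
have dz : z + t%:C%C - z = t%:C%C by rewrite addrC addKr.
have nt : normc (z + t%:C%C - z) = t by rewrite dz normc_real gtr0_norm.
have {H1} := H1 (z + t%:C%C); rewrite nt => /(_ td1).
have {H2} := H2 (z + t%:C%C); rewrite nt => /(_ td2).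
have fz : f z = g z.
  by have := fg 0; rewrite normr0 rmorph0 addr0; apply.
rewrite fg ?gtr0_norm // fz dz.
set X := g _ - g z => le2 le1.
have : normc ((a - b) * t%:C%C) <= normc (X - b * t%:C%C) + normc (X - a * t%:C%C).
  have -> : (a - b) * t%:C%C = (X - b * t%:C%C) - (X - a * t%:C%C) by ring.
  exact: normcB_le.
rewrite normcM normc_real gtr0_norm //.
by have := mulr_gt0 ab0 t0; lra.
Qed.

Lemma has_cderiv_derive1 f z a : has_cderiv f z a -> f^`()%classic z = a.
Proof.
move=> fa; apply: (@real_cderiv_unique f f z) (fa) _; last by exists 1.
exact/differentiable_has_cderiv/(has_cderiv_differentiable fa).
Qed.

Definition continuous_atC f z := forall e, 0 < e ->
  exists2 d, 0 < d & forall w, normc (w - z) < d -> normc (f w - f z) < e.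

Lemma differentiable_continuousC f z :
  differentiable f z -> continuous_atC f z.
Proof.
move=> df e e0.
have [d d0 dP] := differentiable_has_cderiv df ltr01.
pose a := f^`()%classic z; pose K := 1 + normc a.
have K0 : 0 < K by have := normc_ge0 a; rewrite /K; lra.
exists (Num.min d (e / K)); first by rewrite lt_min d0 divr_gt0.
move=> w; rewrite lt_min => /andP[wd we].
have := dP _ wd => H.
have : normc (f w - f z) <= normc (f w - f z - a * (w - z)) + normc (a * (w - z)).
  by rewrite -[X in normc X <= _](subrK (a * (w - z))) normcD_le.
rewrite normcM => H2.
have : normc (w - z) * K < e by rewrite -ltr_pdivlMr.
rewrite /K mulrDr; rewrite -/a in H; nra.
Qed.

End ComplexDerivative.

(** * Complex-valued functions of a real variable *)

Section RealLine.
Context {R : realType}.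
Local Notation C := R[i].
Implicit Types (z w u : C) (x y e d s t : R).

Lemma normc_is_derive (g : R -> R) t b :
  (forall e, 0 < e -> exists2 d, 0 < d & forall s, `|s - t| < d ->
     `|g s - g t - b * (s - t)| <= e * `|s - t|) -> is_derive t 1 g b.
Proof.
move=> H.
have L : (fun h : R => h^-1 *: ((g \o shift t) (h *: (1 : R)) - g t)) @ 0^' --> b.
  apply/cvgrPdist_le => e e0; have [d d0 dP] := H _ e0.
  rewrite near_withinE; apply/(@nbhs_ballP R R); exists d => //= h.
  rewrite -ball_normE /= sub0r normrN => hd h0.
  have := dP (h + t); rewrite addrK => /(_ hd).
  rewrite /= -[h *: 1]/(h * 1) mulr1 -[_^-1 *: _]/(_^-1 * _) distrC.
  have <- : h^-1 * (b * h - (g (h + t) - g t)) = b - h^-1 * (g (h + t) - g t).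
    by field.
  by rewrite normrM normfV ler_pdivrMl ?normr_gt0 // [leRHS]mulrC.
by split; [apply/cvg_ex; exists b; exact: L | exact/cvg_lim].
Qed.

Definition has_rderiv (H : R -> C) t (h : C) :=
  is_derive t 1 (fun s => complex.Re (H s)) (complex.Re h) /\
  is_derive t 1 (fun s => complex.Im (H s)) (complex.Im h).

Lemma has_cderiv_line (f : C -> C) p v t a : has_cderiv f (p + t%:C%C * v) a ->
  has_rderiv (fun s => f (p + s%:C%C * v)) t (a * v).
Proof.
move=> fa.
have key e : 0 < e -> exists2 d, 0 < d & forall s, `|s - t| < d ->
   normc (f (p + s%:C%C * v) - f (p + t%:C%C * v) - (a * v) * (s - t)%:C%C) <=
   e * `|s - t|.
  move=> e0; pose K := 1 + normc v.
  have K0 : 0 < K by rewrite /K; have := normc_ge0 v; lra.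
  have [d d0 dP] := fa (e / K) (divr_gt0 e0 K0).
  exists (d / K) => [|s st]; first exact: divr_gt0.
  have E : p + s%:C%C * v - (p + t%:C%C * v) = (s - t)%:C%C * v.
    by rewrite rmorphB; ring.
  have nE : normc ((s - t)%:C%C * v) = `|s - t| * normc v.
    by rewrite normcM normc_real.
  have le : `|s - t| * normc v <= `|s - t| * K.
    by rewrite ler_wpM2l // /K; lra.
  have := dP (p + s%:C%C * v); rewrite E nE.
  have -> : a * ((s - t)%:C%C * v) = a * v * (s - t)%:C%C by ring.
  rewrite ltr_pdivlMr // in st => /(_ (le_lt_trans le st)) H.
  apply: le_trans H _; rewrite mulrAC ler_pdivrMr // -mulrA.
  by rewrite ler_wpM2l // ltW.
split; apply: normc_is_derive => e e0; have [d d0 dP] := key e e0;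
  exists d => // s sd.
  have := le_trans (Re_le_normc _) (dP s sd).
  by rewrite !Re_add !Re_opp [X in _ - X]Re_mul /= mulr0 subr0.
have := le_trans (Im_le_normc _) (dP s sd).
by rewrite !Im_add !Im_opp [X in _ - X]Im_mul /= mulr0 add0r.
Qed.

Lemma has_rderivD (H1 H2 : R -> C) t h1 h2 :
  has_rderiv H1 t h1 -> has_rderiv H2 t h2 ->
  has_rderiv (fun s => H1 s + H2 s) t (h1 + h2).
Proof.
move=> [r1 i1] [r2 i2]; split.
  have := is_deriveD r1 r2; rewrite -Re_add; congr is_derive.
  by apply/funext => s /=; rewrite Re_add.
have := is_deriveD i1 i2; rewrite -Im_add; congr is_derive.
by apply/funext => s /=; rewrite Im_add.
Qed.

Lemma has_rderivZ (H : R -> C) t h u :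
  has_rderiv H t h -> has_rderiv (fun s => u * H s) t (u * h).
Proof.
move=> [r i]; split; rewrite ?(Re_mul u h) ?(Im_mul u h).
  have := is_deriveB (is_deriveZ (complex.Re u) r) (is_deriveZ (complex.Im u) i).
  by congr is_derive; apply/funext => s /=; rewrite Re_mul.
have := is_deriveD (is_deriveZ (complex.Re u) i) (is_deriveZ (complex.Im u) r).
by congr is_derive; apply/funext => s /=; rewrite Im_mul.
Qed.

(** The mean value theorem fails for complex values; it is applied to the real
    part of [u * H], with [u] the unimodular number that turns [H b - H a] into
    its modulus. *)
Lemma has_rderiv_bound (H h : R -> C) a b M : a <= b ->
  (forall t, a <= t <= b -> has_rderiv H t (h t)) ->
  (forall t, a <= t <= b -> normc (h t) <= M) ->
  normc (H b - H a) <= M * (b - a).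
Proof.
move=> ab dH hM; have [D0|D0] := eqVneq (H b - H a) 0.
  rewrite D0 normc0; apply: mulr_ge0; last by rewrite subr_ge0.
  by apply: le_trans (hM a _); rewrite ?normc_ge0 // lexx.
pose u := (H b - H a)^-1 * (normc (H b - H a))%:C%C.
have n0 : 0 < normc (H b - H a) by rewrite normc_gt0.
have nu : normc u = 1.
  by rewrite normcM normcV normc_real gtr0_norm // mulVf // gt_eqF.
have Eu : u * (H b - H a) = (normc (H b - H a))%:C%C by rewrite /u; field.
have du t : a <= t <= b -> is_derive t 1 (fun s => complex.Re (u * H s))
    (complex.Re (u * h t)).
  by move=> tab; case: (has_rderivZ u (dH t tab)).
have [t|t|c] := @MVT_segment R (fun s => complex.Re (u * H s))
  (fun t => complex.Re (u * h t)) a b ab.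
- by rewrite in_itv /= => /andP[/ltW ? /ltW ?]; apply: du; apply/andP.
- apply: (@derivable_within_continuous R R) => x; rewrite in_itv /=.
  by case/du.
rewrite in_itv /= => cab.
have -> : complex.Re (u * H b) - complex.Re (u * H a) = normc (H b - H a).
  by have := congr1 (@complex.Re R) Eu; rewrite mulrBr Re_add Re_opp.
move=> ->; apply: ler_wpM2r; first by rewrite subr_ge0.
apply: le_trans (ler_norm _) _; apply: le_trans (Re_le_normc _) _.
by rewrite normcM nu mul1r hM.
Qed.

(** The increment of a primitive depends only on the integrand: it is what the
    integral of [h] on [a, b] means below. *)
Lemma has_rderiv_eq (H1 H2 h : R -> C) a b : a <= b ->
  (forall t, a <= t <= b -> has_rderiv H1 t (h t)) ->
  (forall t, a <= t <= b -> has_rderiv H2 t (h t)) ->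
  H1 b - H1 a = H2 b - H2 a.
Proof.
move=> ab d1 d2; apply/eqP; rewrite -subr_eq0; apply/eqP/eq0_normc.
have dH t : a <= t <= b -> has_rderiv (fun s => H1 s + (-1) * H2 s) t
    ((fun t => h t + (-1) * h t) t).
  by move=> tab; apply: has_rderivD (d1 t tab) (has_rderivZ _ (d2 t tab)).
have h0 t : a <= t <= b -> normc ((fun t => h t + (-1) * h t) t) <= 0.
  by move=> _; rewrite mulN1r subrr normc0.
have := has_rderiv_bound ab dH h0; rewrite mul0r => le0.
apply/eqP; rewrite eq_le normc_ge0 andbT.
suff <- : H1 b + -1 * H2 b - (H1 a + -1 * H2 a) = H1 b - H1 a - (H2 b - H2 a) by [].
by ring.
Qed.

End RealLine.

(** * Primitives on a segment *)

Section Primitive.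
Context {R : realType}.
Local Notation C := R[i].
Local Notation mu := (@lebesgue_measure R).

(** Extending [h] by constants outside [a, b] makes it continuous everywhere, so
    that the fundamental theorem of calculus also gives two-sided derivatives at
    the end points. *)
Lemma primitiveR (h : R -> R) (a b : R) : a <= b ->
  (forall t, a <= t <= b -> {for t, continuous h}) ->
  exists H : R -> R, forall t, a <= t <= b -> is_derive t 1 H (h t).
Proof.
move=> ab hc; pose cl (t : R) := Num.max a (Num.min b t).
have clab t : a <= cl t <= b by rewrite le_max lexx /= ge_max ab ge_min lexx.
have cl_id t : a <= t <= b -> cl t = t.
  by move=> /andP[t1 t2]; rewrite /cl min_r // max_r.
have clc : continuous cl.
  move=> t; apply: (@continuous_max _ R (cst a)); first exact: cvg_cst.
  by apply: (@continuous_min _ R (cst b)); [exact: cvg_cst|exact: cvg_id].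
have hcl : continuous (h \o cl).
  by move=> t; apply: continuous_comp; [exact: clc | exact: hc (clab t)].
have int : mu.-integrable `[a - 1, b + 1] (EFin \o (h \o cl)).
  apply: continuous_compact_integrable; first exact: segment_compact.
  exact: continuous_subspaceT.
exists (fun x => \int[mu]_(t in [set` `[a - 1, x]]) (h \o cl) t)%R => t tab.
have [t1 t2] := andP tab.
have [] := @continuous_FTC1_closed R (h \o cl) (a - 1) t (b + 1).
- by apply: le_lt_trans t2 _; lra.
- exact: int.
- by apply: lt_le_trans t1; lra.
- exact: hcl.
by move=> dF; rewrite derive1E /= cl_id // => <-; exact/derivableP.
Qed.

Lemma primitiveC (h : R -> C) (a b : R) : a <= b ->
  (forall t, a <= t <= b -> forall e : R, 0 < e ->
    exists2 d : R, 0 < d & forall s, `|s - t| < d -> normc (h s - h t) < e) ->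
  exists H : R -> C, forall t, a <= t <= b -> has_rderiv H t (h t).
Proof.
move=> ab hc.
have cont (p : C -> R) : (forall z w, p (z - w) = p z - p w) ->
    (forall z, `|p z| <= normc z) ->
    forall t, a <= t <= b -> {for t, continuous (fun s => p (h s))}.
  move=> pB pn t tab; apply/(@cvgrPdist_lt R R) => e e0.
  have [d d0 dP] := hc t tab e e0.
  apply/(@nbhs_ballP R R); exists d => //= s; rewrite -ball_normE /= => ts.
  rewrite distrC -pB; apply: le_lt_trans (pn _) (dP s _).
  by rewrite distrC.
have [H1 dH1] := primitiveR ab (cont (@complex.Re R)
  (fun z w => etrans (Re_add _ _) (congr1 _ (Re_opp w))) Re_le_normc).
have [H2 dH2] := primitiveR ab (cont (@complex.Im R)
  (fun z w => etrans (Im_add _ _) (congr1 _ (Im_opp w))) Im_le_normc).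
by exists (fun t => Complex (H1 t) (H2 t)) => t tab; split; [exact: dH1|exact: dH2].
Qed.

End Primitive.

Local Open Scope complex_scope.

(** * Cauchy's theorem on rectangles *)

Section Goursat.
Context {R : realType}.
Local Notation C := R[i].
Implicit Types (z w p : C) (k f : C -> C).

Lemma has_cderiv_horizontal f (x y : R) (a : C) : has_cderiv f (x +i* y) a ->
  has_rderiv (fun s => f (s +i* y)) x a.
Proof.
have E (s : R) : s +i* y = (0 +i* y) + s%:C * 1.
  by apply: complex_eqP; rewrite /= ?ReImE /=; ring.
rewrite E => /has_cderiv_line; rewrite mulr1; congr has_rderiv.
by apply/funext => s; rewrite -E.
Qed.

Lemma has_cderiv_vertical f (x y : R) (a : C) : has_cderiv f (x +i* y) a ->
  has_rderiv (fun s => f (x +i* s)) y ('i * a).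
Proof.
have E (s : R) : x +i* s = x%:C + s%:C * 'i.
  by apply: complex_eqP; rewrite /= ?ReImE /=; ring.
rewrite E => /has_cderiv_line; rewrite [a * _]mulrC; congr has_rderiv.
by apply/funext => s; rewrite -E.
Qed.

(** A primitive of the affine function [c0 + c1 * (z - p)]. *)
Definition taylor2 p (c0 c1 : C) z := c0 * (z - p) + c1 / 2 * (z - p) ^+ 2.

Lemma has_cderiv_taylor2 p c0 c1 z :
  has_cderiv (taylor2 p c0 c1) z (c0 + c1 * (z - p)).
Proof.
move=> e e0; pose K := 1 + normc (c1 / 2).
have K0 : 0 < K by rewrite /K; have := normc_ge0 (c1 / 2); lra.
exists (e / K) => [|w]; first exact: divr_gt0.
rewrite ltr_pdivlMr // => wz.
have -> : taylor2 p c0 c1 w - taylor2 p c0 c1 z - (c0 + c1 * (z - p)) * (w - z)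
   = (c1 / 2) * (w - z) * (w - z) by rewrite /taylor2; field.
rewrite normcM (normcM (c1 / 2)); apply: ler_wpM2r; first exact: normc_ge0.
apply: le_trans (ltW wz); rewrite mulrC; apply: ler_wpM2l; first exact: normc_ge0.
by rewrite /K lerDr.
Qed.

(** The counterclockwise boundary integral over a rectangle of the function
    that has primitive [A y] on each horizontal and [B x] on each vertical
    line. *)
Definition contour (A B : R -> R -> C) (x1 x2 y1 y2 : R) : C :=
  (A y1 x2 - A y1 x1) + 'i * (B x2 y2 - B x2 y1)
  - (A y2 x2 - A y2 x1) - 'i * (B x1 y2 - B x1 y1).

Variables (k : C -> C) (a b c d : R) (A B : R -> R -> C).
Hypothesis kdiff : forall x y, a <= x <= b -> c <= y <= d ->
  differentiable k (x +i* y).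
Hypothesis Aprim : forall x y, a <= x <= b -> c <= y <= d ->
  has_rderiv (A y) x (k (x +i* y)).
Hypothesis Bprim : forall x y, a <= x <= b -> c <= y <= d ->
  has_rderiv (B x) y (k (x +i* y)).

(** Near a point the integrand is affine up to an error [e * D], where [D] bounds
    the diameter; the affine part has the global primitive [taylor2], whose
    increments along the four sides cancel. Only the error contributes, at most
    [e * D] times the length of the boundary. *)
Lemma contour_small (px py : R) : a <= px <= b -> c <= py <= d ->
  forall e, 0 < e -> exists2 r, 0 < r & forall x1 x2 y1 y2,
  a <= x1 -> x1 <= px <= x2 -> x2 <= b -> c <= y1 -> y1 <= py <= y2 -> y2 <= d ->
  (x2 - x1) + (y2 - y1) < r ->
  normc (contour A B x1 x2 y1 y2) <= 2 * e * ((x2 - x1) + (y2 - y1)) ^+ 2.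
Proof.
move=> pxab pycd e e0; pose p := px +i* py.
have [r r0 rP] := differentiable_has_cderiv (kdiff pxab pycd) e0.
exists r => // x1 x2 y1 y2 ax1 /andP[x1p px2] x2b cy1 /andP[y1p py2] y2d.
set D := (x2 - x1) + (y2 - y1) => Dr.
pose c1 := k^`()%classic p; pose P := taylor2 p (k p) c1.
have in_x x : x1 <= x <= x2 -> a <= x <= b.
  by move=> /andP[? ?]; rewrite (le_trans ax1) // (le_trans _ x2b).
have in_y y : y1 <= y <= y2 -> c <= y <= d.
  by move=> /andP[? ?]; rewrite (le_trans cy1) // (le_trans _ y2d).
have x12 : x1 <= x2 := le_trans x1p px2.
have y12 : y1 <= y2 := le_trans y1p py2.
have err x y : x1 <= x <= x2 -> y1 <= y <= y2 ->
    normc (k (x +i* y) + (-1) * (k p + c1 * (x +i* y - p))) <= e * D.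
  move=> /andP[? ?] /andP[? ?].
  have nD : normc (x +i* y - p) <= D.
    apply: le_trans (normc_le_ReIm _) _; rewrite /p /D /=.
    apply: lerD; rewrite ler_norml; apply/andP; split; lra.
  have := rP (x +i* y) (le_lt_trans nD Dr).
  have -> : k (x +i* y) + (-1) * (k p + c1 * (x +i* y - p)) =
    k (x +i* y) - k p - c1 * (x +i* y - p) by ring.
  move=> H; apply: le_trans H _.
  by apply: ler_wpM2l nD; exact: ltW.
have hor y : y1 <= y <= y2 ->
  normc ((A y x2 + (-1) * P (x2 +i* y)) - (A y x1 + (-1) * P (x1 +i* y)))
    <= e * D * (x2 - x1).
  move=> yy; apply: (@has_rderiv_bound R (fun x => A y x + (-1) * P (x +i* y))
    (fun x => k (x +i* y) + (-1) * (k p + c1 * (x +i* y - p)))).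
  - exact: x12.
  - move=> x xx; apply: has_rderivD.
      by apply: Aprim; [exact: in_x|exact: in_y].
    by apply: has_rderivZ; apply: has_cderiv_horizontal; exact: has_cderiv_taylor2.
  - by move=> x xx; exact: err.
have ver x : x1 <= x <= x2 ->
  normc (('i * B x y2 + (-1) * P (x +i* y2)) - ('i * B x y1 + (-1) * P (x +i* y1)))
    <= e * D * (y2 - y1).
  move=> xx; apply: (@has_rderiv_bound R (fun y => 'i * B x y + (-1) * P (x +i* y))
    (fun y => 'i * (k (x +i* y)) + (-1) * ('i * (k p + c1 * (x +i* y - p))))).
  - exact: y12.
  - move=> y yy; apply: has_rderivD.
      apply: has_rderivZ.
      by apply: Bprim; [exact: in_x|exact: in_y].
    by apply: has_rderivZ; apply: has_cderiv_vertical; exact: has_cderiv_taylor2.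
  - move=> y yy.
    have -> : forall u v, 'i * u + (-1) * ('i * v) = 'i * (u + (-1) * v) :> C.
      by move=> u v; ring.
    by rewrite normcM /= expr0n expr1n add0r sqrtr1 mul1r; exact: err.
have ends (u v : R) : u <= v -> (u <= u <= v) && (u <= v <= v).
  by move=> uv; rewrite !lexx uv.
have /andP[/hor h1 /hor h2] := ends _ _ y12.
have /andP[/ver v1 /ver v2] := ends _ _ x12.
have {h1 h2}h := le_trans (normcB_le _ _) (lerD h1 h2).
have {v1 v2}v := le_trans (normcB_le _ _) (lerD v2 v1).
have E : forall t1 t2 b1 b2 r1 r2 l1 l2 P11 P12 P21 P22 : C,
    (b2 - b1) + 'i * (r2 - r1) - (t2 - t1) - 'i * (l2 - l1) =
    ((b2 + -1 * P21) - (b1 + -1 * P11) - ((t2 + -1 * P22) - (t1 + -1 * P12))) +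
    (('i * r2 + -1 * P22) - ('i * r1 + -1 * P21) -
      (('i * l2 + -1 * P12) - ('i * l1 + -1 * P11))) by move=> *; ring.
rewrite /contour (E _ _ _ _ _ _ _ _ (P (x1 +i* y1)) (P (x1 +i* y2))
  (P (x2 +i* y1)) (P (x2 +i* y2))).
apply: le_trans (normcD_le _ _) _.
apply: le_trans (lerD h v) _.
by rewrite expr2 /D; lra.
Qed.

Lemma contour_split x1 x2 y1 y2 xm ym :
  contour A B x1 x2 y1 y2 =
  contour A B x1 xm y1 ym + contour A B xm x2 y1 ym +
  (contour A B x1 xm ym y2 + contour A B xm x2 ym y2).
Proof. by rewrite /contour; ring. Qed.

Lemma half_interval (l u p q p' : R) : l <= p -> p + (q + q) <= u -> 0 < q ->
  p' = p \/ p' = p + q ->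
  [/\ l <= p', p' + q <= u, p <= p' & p' + q <= p + (q + q)].
Proof. by move=> ? ? ? [] ->; split; lra. Qed.

(** Bisection: one of the four quarters of a rectangle carries at least a quarter
    of the integral, so if the integral had modulus [eta > 0] there would be nested
    similar rectangles, of scale [s] = 2 ^- n, with integrals of modulus at least
    [eta * s ^+ 2]. This contradicts [contour_small] at their common point. *)
Lemma goursat_rectangle : a < b -> c < d -> contour A B a b c d = 0.
Proof.
move=> ab cd; apply: eq0_normc; apply/eqP; rewrite eq_le normc_ge0 andbT.
rewrite leNgt; apply/negP => eta0; pose eta := normc (contour A B a b c d).
pose w := b - a; pose h := d - c.
have w0 : 0 < w by rewrite subr_gt0.
have h0 : 0 < h by rewrite subr_gt0.
(* A triple [(x, y, s)] encodes the rectangle with lower left corner [x +i* y]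
   and sides [s * w] and [s * h]. *)
pose rect (q : R * R * R) := contour A B q.1.1 (q.1.1 + q.2 * w)
  q.1.2 (q.1.2 + q.2 * h).
pose inside (q : R * R * R) := [/\ a <= q.1.1, q.1.1 + q.2 * w <= b, c <= q.1.2,
  q.1.2 + q.2 * h <= d & 0 < q.2].
pose good (q : R * R * R) := inside q /\ eta * q.2 ^+ 2 <= normc (rect q).
pose sub (q q' : R * R * R) := [/\ q'.2 = q.2 / 2,
  q.1.1 <= q'.1.1, q'.1.1 + q'.2 * w <= q.1.1 + q.2 * w,
  q.1.2 <= q'.1.2 & q'.1.2 + q'.2 * h <= q.1.2 + q.2 * h].
have step q : exists q', good q -> good q' /\ sub q q'.
  have [[]|ng] := pselect (good q); last by exists q.
  case: q => [[x y] s] [/= xa xb yc yd s0] /= big.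
  pose t := s / 2; have t0 : 0 < t by rewrite divr_gt0.
  have st : s = t + t by rewrite /t; lra.
  have tw : 0 < t * w by rewrite mulr_gt0.
  have th : 0 < t * h by rewrite mulr_gt0.
  have sw : s * w = t * w + t * w by rewrite st; ring.
  have sh : s * h = t * h + t * h by rewrite st; ring.
  have split4 : rect (x, y, s) = rect (x, y, t) + rect (x + t * w, y, t) +
     (rect (x, y + t * h, t) + rect (x + t * w, y + t * h, t)).
    rewrite /rect /= (contour_split _ _ _ _ (x + t * w) (y + t * h)) sw sh.
    by rewrite !addrA.
  have sub4 x' y' : (x' = x \/ x' = x + t * w) -> (y' = y \/ y' = y + t * h) ->
      inside (x', y', t) /\ sub (x, y, s) (x', y', t).
    rewrite sw in xb; rewrite sh in yd.
    move=> /(half_interval xa xb tw) [? ? ? ?] /(half_interval yc yd th) [? ? ? ?].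
    by rewrite /inside /sub /= sw sh.
  have [h1|h1] := leP (eta * t ^+ 2) (normc (rect (x, y, t))).
    exists (x, y, t) => _.
    by have [] := sub4 _ _ (or_introl erefl) (or_introl erefl).
  have [h2|h2] := leP (eta * t ^+ 2) (normc (rect (x + t * w, y, t))).
    exists (x + t * w, y, t) => _.
    by have [] := sub4 _ _ (or_intror erefl) (or_introl erefl).
  have [h3|h3] := leP (eta * t ^+ 2) (normc (rect (x, y + t * h, t))).
    exists (x, y + t * h, t) => _.
    by have [] := sub4 _ _ (or_introl erefl) (or_intror erefl).
  have [h4|h4] := leP (eta * t ^+ 2) (normc (rect (x + t * w, y + t * h, t))).
    exists (x + t * w, y + t * h, t) => _.
    by have [] := sub4 _ _ (or_intror erefl) (or_intror erefl).
  exfalso; move: big; rewrite leNgt => /negP; apply.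
  rewrite split4; apply: le_lt_trans (normcD_le _ _) _.
  apply: le_lt_trans (lerD (normcD_le _ _) (normcD_le _ _)) _.
  have -> : eta * s ^+ 2 = eta * t ^+ 2 * 4 by rewrite st; ring.
  by lra.
have [F FP] := choice step.
pose u n := iter n F (a, c, 1).
have good_u n : good (u n).
  elim: n => [|n IH]; last by case: (FP _ IH).
  split; last by rewrite /rect /eta /= expr1n mulr1 !mul1r !subrKC.
  by rewrite /inside /= !mul1r !subrKC !lexx ltr01.
have sub_u n : sub (u n) (u n.+1) by case: (FP _ (good_u n)).
have su n : (u n).2 = 2^-1 ^+ n.
  elim: n => [|n IH]; first by rewrite expr0.
  by case: (sub_u n) => ->; rewrite IH exprSr.
have mono m n : [/\ (u m).1.1 <= (u n).1.1 + (u n).2 * w &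
                    (u m).1.2 <= (u n).1.2 + (u n).2 * h].
  have up i j : (u i).1.1 <= (u (i + j)%N).1.1 /\ (u i).1.2 <= (u (i + j)%N).1.2.
    elim: j => [|j [I1 I2]]; first by rewrite addn0.
    rewrite addnS; case: (sub_u (i + j)%N) => _ ? _ ? _.
    by split; [apply: le_trans I1 _|apply: le_trans I2 _].
  have dn i j : (u (i + j)%N).1.1 + (u (i + j)%N).2 * w <= (u i).1.1 + (u i).2 * w
     /\ (u (i + j)%N).1.2 + (u (i + j)%N).2 * h <= (u i).1.2 + (u i).2 * h.
    elim: j => [|j [I1 I2]]; first by rewrite addn0.
    rewrite addnS; case: (sub_u (i + j)%N) => _ _ ? _ ?.
    by split; [apply: le_trans I1|apply: le_trans I2].
  have [[_ _ _ _ s0] _] := good_u (m + n)%N.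
  have [u1 u2] := up m n; have := dn n m; rewrite addnC => -[d1 d2].
  have := mulr_gt0 s0 w0; have := mulr_gt0 s0 h0; split; lra.
(* The lower left corners increase to a point of all the rectangles. *)
pose X := [set (u n).1.1 | n in [set: nat]].
pose Y := [set (u n).1.2 | n in [set: nat]].
have X0 : X !=set0 by exists (u 0%N).1.1, 0%N.
have Y0 : Y !=set0 by exists (u 0%N).1.2, 0%N.
have Xub n : ubound X ((u n).1.1 + (u n).2 * w).
  by move=> _ [m _ <-]; case: (mono m n).
have Yub n : ubound Y ((u n).1.2 + (u n).2 * h).
  by move=> _ [m _ <-]; case: (mono m n).
have Xin n : (u n).1.1 <= sup X <= (u n).1.1 + (u n).2 * w.
  apply/andP; split; last exact: (sup_le_ub X0).
  by apply: ub_le_sup; [exists ((u 0%N).1.1 + (u 0%N).2 * w) | exists n].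
have Yin n : (u n).1.2 <= sup Y <= (u n).1.2 + (u n).2 * h.
  apply/andP; split; last exact: (sup_le_ub Y0).
  by apply: ub_le_sup; [exists ((u 0%N).1.2 + (u 0%N).2 * h) | exists n].
have pX : a <= sup X <= b by have := Xin 0%N; rewrite /= mul1r subrKC.
have pY : c <= sup Y <= d by have := Yin 0%N; rewrite /= mul1r subrKC.
have wh0 : 0 < w + h by rewrite addr_gt0.
(* With this [e], [contour_small] gives half of the lower bound. *)
pose e := eta / (4 * (w + h) ^+ 2).
have e0 : 0 < e by rewrite divr_gt0 // mulr_gt0 // exprn_gt0.
have [r r0 rP] := contour_small pX pY e0.
have [n nr] : exists n, (u n).2 * (w + h) < r.
  have r1 : 0 < r / (w + h) by rewrite divr_gt0.
  have := @cvg_geometric R 1 2^-1.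
  rewrite gtr0_norm ?invr_gt0 // invf_lt1 ?ltr1n // => /(_ isT).
  move=> /cvgrPdist_lt /(_ _ r1) [n _ /(_ n (leqnn n))].
  rewrite /= sub0r normrN mul1r ger0_norm ?exprn_ge0 // => nr.
  by exists n; rewrite su -ltr_pdivlMr.
have [[ua ub uc ud s0] big] := good_u n.
have := rP (u n).1.1 ((u n).1.1 + (u n).2 * w) (u n).1.2 ((u n).1.2 + (u n).2 * h)
   ua (Xin n) ub uc (Yin n) ud.
have -> : (u n).1.1 + (u n).2 * w - (u n).1.1 + ((u n).1.2 + (u n).2 * h - (u n).1.2)
  = (u n).2 * (w + h) by ring.
move=> /(_ nr) /(le_trans big).
have -> : 2 * e * ((u n).2 * (w + h)) ^+ 2 = eta * (u n).2 ^+ 2 / 2.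
  by rewrite /e; field; rewrite gt_eqF.
have : 0 < eta * (u n).2 ^+ 2 by rewrite mulr_gt0 // exprn_gt0.
lra.
Qed.

End Goursat.

(** * The complex exponential *)

Section Cexp.
Context {R : realType}.
Local Notation C := R[i].
Implicit Types (z w : C).

Lemma is_derive_le (g : R -> R) (t b : R) : is_derive t 1 g b ->
  forall e : R, 0 < e -> exists2 d, 0 < d & forall s, `|s - t| < d ->
    `|g s - g t - b * (s - t)| <= e * `|s - t|.
Proof.
move=> [dg gb] e e0.
have : (fun h : R => h^-1 *: ((g \o shift t) (h *: (1 : R)) - g t)) @ 0^' --> b.
  by rewrite -gb; exact: dg.
move=> /cvgrPdist_le /(_ _ e0); rewrite near_withinE => /(@nbhs_ballP R R) [d /= d0 dP].
exists d => // s st; have [->|nst] := eqVneq s t.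
  by rewrite !subrr mulr0 subrr normr0 mulr0.
have st0 : s - t != 0 by rewrite subr_eq0.
have := dP (s - t); rewrite -ball_normE /= sub0r normrN => /(_ st st0).
rewrite -[(s - t) *: 1]/((s - t) * 1) mulr1 -[_^-1 *: _]/(_^-1 * _) subrK distrC.
have -> : g s - g t - b * (s - t) = (s - t) * ((s - t)^-1 * (g s - g t) - b).
  by field.
by move=> H; rewrite normrM mulrC ler_wpM2r.
Qed.

Definition cexp z : C := (expR (complex.Re z) * cos (complex.Im z)) +i*
  (expR (complex.Re z) * sin (complex.Im z)).

Lemma cexpD z w : cexp (z + w) = cexp z * cexp w.
Proof.
apply: complex_eqP; rewrite ?Re_mul ?Im_mul /cexp /= !ReImE expRD ?cosD ?sinD; ring.
Qed.

Lemma normc_cexp z : normc (cexp z) = expR (complex.Re z).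
Proof.
by rewrite /= !exprMn -mulrDr cos2Dsin2 mulr1 sqrtr_sqr ger0_norm // expR_ge0.
Qed.

Lemma cexp0 : cexp 0 = 1.
Proof. by apply: complex_eqP; rewrite /= expR0 mul1r ?cos0 ?sin0. Qed.

(** The three real expansions of [expR], [cos] and [sin] at 0 are combined; the
    errors add up to at most [8 * e' * normc w], hence the choice of [e']. *)
Lemma has_cderiv_cexp0 : has_cderiv cexp 0 1.
Proof.
move=> e e0.
have [e' [e'0 e1 e2]] : exists e', [/\ 0 < e', e' <= 1 & e' <= e / 8].
  by exists (Num.min 1 (e / 8)); rewrite lt_min ltr01 divr_gt0 // !ge_min !lexx orbT.
have [d1 d10 D1] := is_derive_le (is_derive_expR 0) e'0.
have [d2 d20 D2] := is_derive_le (is_derive_cos 0) e'0.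
have [d3 d30 D3] := is_derive_le (is_derive_sin 0) e'0.
exists (Num.min e' (Num.min d1 (Num.min d2 d3))) => [|w].
  by rewrite !lt_min e'0 d10 d20 d30.
rewrite subr0 !lt_min => /and4P[we w1 w2 w3].
have rw := Re_le_normc w; have iw := Im_le_normc w.
set x := complex.Re w in rw *; set y := complex.Im w in iw *.
have {D1} := D1 x; rewrite subr0 expR0 mul1r => /(_ (le_lt_trans rw w1)) D1.
have {D2} := D2 y; rewrite subr0 cos0 sin0 oppr0 mul0r subr0 => /(_ (le_lt_trans iw w2)) D2.
have {D3} := D3 y; rewrite !subr0 sin0 cos0 subr0 mul1r => /(_ (le_lt_trans iw w3)) D3.
set E := expR x - 1 - x in D1; set K := cos y - 1 in D2; set S := sin y - y in D3.
have n0 := normc_ge0 w.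
rewrite cexp0 mul1r; apply: le_trans (normc_le_ReIm _) _.
rewrite !ReImE /= -/x -/y.
have -> : expR x * cos y - 1 - x = E * cos y + (1 + x) * K.
  by rewrite /E /K; ring.
have -> : expR x * sin y - 0 - y = (E + x) * (S + y) + S by rewrite /E /S; ring.
have nE : `|E| <= e' * normc w by apply: le_trans D1 _; rewrite ler_wpM2l // ltW.
have nK : `|K| <= e' * normc w by apply: le_trans D2 _; rewrite ler_wpM2l // ltW.
have nS : `|S| <= e' * normc w by apply: le_trans D3 _; rewrite ler_wpM2l // ltW.
have c1 : `|cos y| <= 1 by exact: cos_max.
have a1 : `|E * cos y| <= e' * normc w.
  by rewrite normrM; apply: le_trans nE; rewrite ler_piMr.
have x1 : `|1 + x| <= 2.
  by apply: le_trans (ler_normD _ _) _; rewrite normr1; lra.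
have a2 : `|(1 + x) * K| <= 2 * (e' * normc w) by rewrite normrM ler_pM.
have b1 : `|E + x| <= 2 * e'.
  apply: le_trans (ler_normD _ _) _.
  have : e' * normc w <= e' * 1 by rewrite ler_pM2l //; lra.
  lra.
have b2 : `|S + y| <= 2 * normc w.
  apply: le_trans (ler_normD _ _) _.
  have : e' * normc w <= 1 * normc w by rewrite ler_wpM2r.
  lra.
have a3 : `|(E + x) * (S + y)| <= (2 * e') * (2 * normc w) by rewrite normrM ler_pM.
have a4 := ler_normD (E * cos y) ((1 + x) * K).
have a5 := ler_normD ((E + x) * (S + y)) S.
have : e' * normc w <= e / 8 * normc w by rewrite ler_wpM2r.
lra.
Qed.

Lemma has_cderiv_cexp z : has_cderiv cexp z (cexp z).
Proof.
move=> e e0; have [|d d0 dP] := has_cderiv_cexp0 (e := e / expR (complex.Re z)).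
  by rewrite divr_gt0 ?expR_gt0.
exists d => // w wz; have := dP (w - z); rewrite subr0 => /(_ wz).
rewrite cexp0 mul1r => H.
have -> : cexp w - cexp z - cexp z * (w - z) =
    cexp z * (cexp (w - z) - 1 - (w - z)).
  by rewrite !mulrBr mulr1 -cexpD [z + _]addrC subrK; ring.
rewrite normcM normc_cexp; have E0 := expR_gt0 (complex.Re z).
have := ler_wpM2l (ltW E0) H.
by rewrite mulrA [expR _ * (e / _)]mulrC divfK // gt_eqF.
Qed.

Lemma differentiable_cexp z : differentiable cexp z.
Proof. exact: has_cderiv_differentiable (has_cderiv_cexp z). Qed.

End Cexp.

(** * Maximum principle *)

Section MaximumPrinciple.
Context {R : realType}.
Local Notation C := R[i].
Implicit Types (f g : C -> C) (z w : C).

Lemma differentiable_compC f g z : differentiable f z ->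
  differentiable g (f z) -> differentiable (fun w => g (f w)) z.
Proof. by move=> df dg; exact (@differentiable_comp _ _ _ _ f g z df dg). Qed.

(** In the logarithmic coordinate, [f (cexp z)] is holomorphic on a left half-plane
    and has period [2 * pi * 'i]. Cauchy's theorem on a rectangle of that height
    says that its integral over a vertical side, which is [2 * pi] times the
    mean of [f] over a circle about 0, does not depend on the radius. As the
    radius tends to 0 the mean tends to [f 0]; only continuity of [f] at 0 is
    used there, so that the lemma also applies to difference quotients. *)
Lemma center_le_circle f (r rho M : R) : 0 < rho < r -> continuous_atC f 0 ->
  (forall z, 0 < normc z < r -> differentiable f z) ->
  (forall z, normc z = rho -> normc (f z) <= M) -> normc (f 0) <= M.
Proof.
move=> /andP[rho0 rhor] f0 df fM; apply/ler_addgt0Pr => e e0.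
have [d d0 dP] := f0 _ e0.
(* [x1] is the logarithm of a radius on which [f] is [e]-close to [f 0]. *)
pose x2 := ln rho; pose x1 := Num.min (ln (d / 2)) (x2 - 1).
have x12 : x1 < x2 by rewrite /x1 gt_min; apply/orP; right; lra.
have x1d : expR x1 < d.
  apply: (@le_lt_trans _ _ (expR (ln (d / 2)))).
    by rewrite ler_expR ge_min lexx.
  by rewrite lnK ?posrE ?divr_gt0 //; lra.
have x2rho : expR x2 = rho by rewrite lnK.
pose T : R := pi *+ 2; have T0 : 0 < T by rewrite /T mulrn_wgt0 // pi_gt0.
pose k z := f (cexp z).
have dk x y : x1 <= x <= x2 -> 0 <= y <= T -> differentiable k (x +i* y).
  move=> /andP[_ xx2] _; apply: differentiable_compC; first exact: differentiable_cexp.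
  apply: df; rewrite normc_cexp /= expR_gt0 /=; apply: le_lt_trans rhor.
  by rewrite -x2rho ler_expR.
have exA y : exists a : R -> C, 0 <= y <= T -> forall x, x1 <= x <= x2 ->
    has_rderiv a x (k (x +i* y)).
  have [yT|] := boolP (0 <= y <= T); last by exists (fun=> 0).
  have [|H HP] := primitiveC (h := fun x => k (x +i* y)) (ltW x12); last by exists H.
  move=> x xx e1 e10; have [d1 d10 d1P] := differentiable_continuousC (dk x y xx yT) e10.
  exists d1 => // s sx; apply: d1P; rewrite -[_ - _]/((s - x) +i* (y - y)) subrr.
  by rewrite -[_ +i* 0]/((s - x)%:C) normc_real.
have exB x : exists b : R -> C, x1 <= x <= x2 -> forall y, 0 <= y <= T ->
    has_rderiv b y (k (x +i* y)).
  have [xx|] := boolP (x1 <= x <= x2); last by exists (fun=> 0).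
  have [|H HP] := primitiveC (h := fun y => k (x +i* y)) (ltW T0); last by exists H.
  move=> y yT e1 e10; have [d1 d10 d1P] := differentiable_continuousC (dk x y xx yT) e10.
  exists d1 => // s sy; apply: d1P; rewrite -[_ - _]/((x - x) +i* (s - y)) subrr.
  by rewrite /= expr0n add0r sqrtr_sqr.
have [A AP] := choice exA; have [B BP] := choice exB.
have AP' x y : x1 <= x <= x2 -> 0 <= y <= T -> has_rderiv (A y) x (k (x +i* y)).
  by move=> xx yT; exact: AP.
have BP' x y : x1 <= x <= x2 -> 0 <= y <= T -> has_rderiv (B x) y (k (x +i* y)).
  by move=> xx yT; exact: BP.
have := goursat_rectangle dk AP' BP' x12 T0; rewrite /contour.
have TT : 0 <= T <= T by apply/andP; split=> //; exact: ltW.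
have OT : (0 : R) <= (0 : R) <= T by apply/andP; split=> //; exact: ltW.
have x1x : x1 <= x1 <= x2 by apply/andP; split=> //; exact: ltW.
have x2x : x1 <= x2 <= x2 by apply/andP; split=> //; exact: ltW.
(* By periodicity of [k] the two horizontal sides cancel. *)
have -> : A 0 x2 - A 0 x1 = A T x2 - A T x1.
  apply: (has_rderiv_eq (h := fun x => k (x +i* 0)) (ltW x12)) => x xx; first exact: AP.
  have -> : k (x +i* 0) = k (x +i* T); last exact: AP.
  congr f; rewrite /cexp /= cos2pi sin2pi.
  by rewrite cos0 sin0.
have cancel : forall p q s : C, p + 'i * q - p - 'i * s = 'i * (q - s).
  by move=> *; ring.
rewrite cancel => /eqP; rewrite mulf_eq0 => /orP[/eqP[/eqP]|].
  by rewrite oner_eq0.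
rewrite subr_eq0 => /eqP sides.
have b2 : normc (B x2 T - B x2 0) <= M * T.
  rewrite -[X in _ <= _ * X](subr0 T).
  apply: (has_rderiv_bound (h := fun y => k (x2 +i* y)) (ltW T0)) => y yT; first exact: BP.
  by apply: fM; rewrite normc_cexp.
have b1 : normc ((B x1 T + (- f 0) * T%:C) - (B x1 0 + (- f 0) * 0%:C)) <= e * T.
  rewrite -[X in _ <= _ * X](subr0 T).
  apply: (@has_rderiv_bound R (fun y => B x1 y + (- f 0) * y%:C)
     (fun y => k (x1 +i* y) + (- f 0) * 1)) (ltW T0) _ _ => y yT.
    apply: has_rderivD; first exact: BP.
    by apply: has_rderivZ; split; [exact: is_derive_id | exact: is_derive_cst].
  by rewrite mulr1; apply/ltW/dP; rewrite subr0 normc_cexp.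
have fT : normc (f 0 * T%:C) = normc (f 0) * T.
  by rewrite normcM normc_real gtr0_norm.
rewrite -(ler_pM2r T0) -fT mulrDl.
have -> : f 0 * T%:C = (B x1 T - B x1 0) -
  ((B x1 T + - f 0 * T%:C) - (B x1 0 + - f 0 * 0%:C)) by rewrite rmorph0; ring.
by apply: le_trans (normcB_le _ _) _; rewrite -sides lerD.
Qed.

End MaximumPrinciple.

(** * Holomorphic maps into the right half-plane *)

Section HalfPlane.
Context {R : realType}.
Local Notation C := R[i].
Implicit Types (f g : C -> C) (z w : C).

Lemma differentiable_near f g z (d : R) : 0 < d ->
  (forall w, normc (w - z) < d -> f w = g w) -> differentiable f z -> differentiable g z.
Proof.
move=> d0 fg /differentiable_has_cderiv fa.
apply: (@has_cderiv_differentiable _ _ _ (f^`()%classic z)) => e e0.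
have [d1 d10 dP] := fa e e0; exists (Num.min d d1); first by rewrite lt_min d0.
move=> w; rewrite lt_min => /andP[w0 w1]; rewrite -!fg //; first exact: dP.
by rewrite subrr normc0.
Qed.

(** At a zero of [f], continuity of [g] is enough for the product rule. *)
Lemma has_cderivM0 f g z (a : C) : has_cderiv f z a -> f z = 0 ->
  continuous_atC g z -> has_cderiv (fun w => f w * g w) z (a * g z).
Proof.
move=> fa f0 gc e e0; pose K := normc (g z) + 1; pose L := normc a + 1.
have K0 : 0 < K by rewrite ltr_wpDl // normc_ge0.
have L0 : 0 < L by rewrite ltr_wpDl // normc_ge0.
have [d1 d10 d1P] := fa (e / 2 / K) (divr_gt0 (divr_gt0 e0 (ltr0Sn R 1)) K0).
have [d2 d20 d2P] := gc (e / 2 / L) (divr_gt0 (divr_gt0 e0 (ltr0Sn R 1)) L0).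
have [d3 d30 d3P] := gc 1 ltr01.
exists (Num.min d1 (Num.min d2 d3)); first by rewrite !lt_min d10 d20.
move=> w; rewrite !lt_min => /and3P[w1 w2 w3].
have := d1P _ w1; have := d2P _ w2; have := d3P _ w3.
rewrite f0 mul0r !subr0 => g1 g2 f1.
have -> : f w * g w - a * g z * (w - z) =
  (f w - a * (w - z)) * g w + a * (g w - g z) * (w - z) by ring.
apply: le_trans (normcD_le _ _) _; rewrite normcM normcM (normcM a).
have n0 := normc_ge0 (w - z).
have gK : normc (g w) <= K.
  have := normcD_le (g w - g z) (g z); rewrite subrK /K; lra.
have p1 : normc (f w - a * (w - z)) * normc (g w) <= e / 2 / K * normc (w - z) * K.
  by apply: ler_pM; rewrite ?normc_ge0.
have p2 : normc a * normc (g w - g z) * normc (w - z) <= L * (e / 2 / L) * normc (w - z).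
  apply: ler_wpM2r => //; apply: ler_pM; rewrite ?normc_ge0 ?ltW //.
  by rewrite /L; lra.
have -> : e * normc (w - z) = e / 2 / K * normc (w - z) * K + L * (e / 2 / L) * normc (w - z).
  by field; rewrite !gt_eqF.
exact: lerD.
Qed.

Lemma differentiable_shift z0 z : differentiable (fun w : C => z0 + w) z.
Proof.
apply: (@has_cderiv_differentiable _ _ _ 1) => e e0; exists 1 => // w _.
have -> : z0 + w - (z0 + z) - 1 * (w - z) = 0 by ring.
by rewrite normc0 mulr_ge0 ?normc_ge0 // ltW.
Qed.

(** The maximum principle applied to the difference quotient at [z0], on the
    circle of radius [r / 2]. *)
Lemma cauchy_bound f z0 (r M : R) : 0 < r ->
  (forall z, normc (z - z0) < r -> differentiable f z /\ normc (f z) <= M) ->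
  normc (f^`()%classic z0) <= 4 * M / r.
Proof.
move=> r0 H; have z0r : normc (z0 - z0) < r by rewrite subrr normc0.
have [df0 _] := H _ z0r.
pose q w := if w == 0 then f^`()%classic z0 else (f (z0 + w) - f z0) * w^-1.
have -> : f^`()%classic z0 = q 0 by rewrite /q eqxx.
have r2 : 0 < r / 2 < r by apply/andP; split; lra.
apply: (@center_le_circle R q r (r / 2) (4 * M / r) r2).
- move=> e e0; have [d d0 dP] := differentiable_has_cderiv df0 (divr_gt0 e0 (ltr0Sn R 1)).
  exists d => // w; rewrite subr0 => wd; rewrite {2}/q eqxx /q.
  have [w0|w0] := eqVneq w 0; first by rewrite subrr normc0.
  have := dP (z0 + w); rewrite addrAC subrr add0r => /(_ wd) le.
  have -> : (f (z0 + w) - f z0) * w^-1 - f^`()%classic z0 =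
    (f (z0 + w) - f z0 - f^`()%classic z0 * w) * w^-1 by field.
  rewrite normcM normcV ltr_pdivrMr ?normc_gt0 //; apply: le_lt_trans le _.
  by rewrite ltr_pM2r ?normc_gt0 //; lra.
- move=> z /andP[z_gt0 zr].
  apply: (@differentiable_near (fun w => (f (z0 + w) - f z0) * w^-1) q z (normc z) z_gt0).
    move=> w wz; rewrite /q; case: eqVneq => // w0.
    by move: wz; rewrite w0 sub0r normc_opp ltxx.
  apply: differentiableM.
    apply: differentiableB; last exact: differentiable_cst.
    apply: (@differentiable_compC R (fun w => z0 + w)); first exact: differentiable_shift.
    by case: (H (z0 + z)) => //; rewrite addrC addKr.
  apply: differentiableV; last by rewrite -normc_gt0.
  exact: (@ex_diff _ _ _ _ _ _ _ (is_diff_id z)).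
move=> z zr; have z1 : z != 0 by rewrite -normc_gt0 zr; case/andP: r2.
rewrite /q (negPf z1) normcM normcV zr.
have [_ m1] := H _ z0r; have [|_ m2] := H (z0 + z); first by rewrite addrC addKr zr; lra.
have -> : 4 * M / r = (M + M) / (r / 2) by field; rewrite gt_eqF.
rewrite ler_pM2r ?invr_gt0; last by case/andP: r2.
by apply: le_trans (normcB_le _ _) _; lra.
Qed.

Lemma Re_conjc z : complex.Re z^* = complex.Re z.
Proof. by case: z. Qed.

Lemma Im_conjc z : complex.Im z^* = - complex.Im z.
Proof. by case: z. Qed.

Lemma normc_cayley z w : 0 < complex.Re z -> 0 < complex.Re w ->
  normc (z - w) <= normc (z + w^*).
Proof.
rewrite -ler_sqr ?nnegrE ?normc_ge0 // !sqr_normcE.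
by case: z w => x y [u v] /= ? ?; nra.
Qed.

(** The Cayley transform centred at [f z0] maps the right half-plane to the unit
    disc, and its composition with [f] has derivative
    [f' z0 / (2 * Re (f z0))] at [z0]. *)
Lemma right_half_plane_bound f z0 (r : R) : 0 < r ->
  (forall z, normc (z - z0) < r -> differentiable f z /\ 0 < complex.Re (f z)) ->
  normc (f^`()%classic z0) <= 8 * complex.Re (f z0) / r.
Proof.
move=> r0 H; have z0r : normc (z0 - z0) < r by rewrite subrr normc0.
have [df0 Rf0] := H _ z0r; set a := f z0 in Rf0 *.
pose N z := f z - a; pose D z := (f z + a^*)^-1.
have Rpos z : normc (z - z0) < r -> 0 < complex.Re (f z + a^*).
  by move=> /H[_ ?]; rewrite Re_add Re_conjc addr_gt0.
have Dne z : normc (z - z0) < r -> f z + a^* != 0.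
  by move=> /Rpos; apply: contraTneq => ->; rewrite ltxx.
have dN z : normc (z - z0) < r -> differentiable N z.
  by move=> /H[dz _]; apply: differentiableB; last exact: differentiable_cst.
have dD z : normc (z - z0) < r -> differentiable D z.
  move=> zr; have [dz _] := H _ zr.
  rewrite /D; apply: differentiableV; last exact: Dne.
  by apply: differentiableD; last exact: differentiable_cst.
have dG z : normc (z - z0) < r -> differentiable (fun w => N w * D w) z.
  by move=> zr; apply: differentiableM; [exact: dN|exact: dD].
have nG z : normc (z - z0) < r -> normc (N z * D z) <= 1.
  move=> zr; rewrite normcM normcV ler_pdivrMr ?normc_gt0 ?Dne // mul1r.
  by apply: normc_cayley => //; case: (H z zr).
have [N0 cN] : N z0 = 0 /\ has_cderiv N z0 (f^`()%classic z0).
  split; first by rewrite /N subrr.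
  move=> e e0; have [d d0 dP] := differentiable_has_cderiv df0 e0.
  by exists d => // w /dP; rewrite /N opprB addrA subrK.
have cG := has_cderivM0 cN N0 (fun e e0 => differentiable_continuousC (dD z0 z0r) e0).
have := cauchy_bound r0 (fun z zr => conj (dG z zr) (nG z zr)).
rewrite (has_cderiv_derive1 cG) normcM.
have -> : D z0 = (2 * complex.Re a)%:C^-1.
  congr (_^-1); rewrite -/a; apply: complex_eqP; rewrite ?Re_add ?Im_add ?Re_conjc /=.
    by ring.
  by rewrite Im_conjc subrr.
rewrite normcV normc_real gtr0_norm ?mulr_gt0 // ler_pdivrMr ?mulr_gt0 // => le.
by apply: le_trans le _; rewrite le_eqVlt; apply/orP; left; apply/eqP; field; rewrite gt_eqF.
Qed.

Lemma constant_on_segment f p v :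
  (forall t : R, 0 <= t <= 1 -> has_cderiv f (p + t%:C * v) 0) -> f (p + v) = f p.
Proof.
move=> H; apply/eqP; rewrite -subr_eq0; apply/eqP/eq0_normc/eqP.
rewrite eq_le normc_ge0 andbT.
have zero (t : R) : 0 <= t <= 1 -> normc (0 * v) <= 0 by rewrite mul0r normc0.
have := @has_rderiv_bound R (fun t => f (p + t%:C * v)) (fun _ => 0 * v) 0 1 0 ler01
  (fun t t01 => has_cderiv_line (H t t01)) zero.
by rewrite [X in _ <= X]mul0r rmorph1 rmorph0 mul1r mul0r addr0.
Qed.

(** Liouville's theorem: [right_half_plane_bound] holds for every radius. *)
Lemma entire_right_half_plane f : (forall z, differentiable f z) ->
  (forall z, 0 < complex.Re (f z)) -> forall z w, f z = f w.
Proof.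
move=> df Rf; have f0 z : has_cderiv f z 0.
  suff <- : f^`()%classic z = 0 by exact: differentiable_has_cderiv.
  apply/eq0_normc/eqP; rewrite eq_le normc_ge0 andbT; apply/ler_addgt0Pr => e e0.
  have r0 : 0 < 8 * complex.Re (f z) / e by rewrite divr_gt0 // mulr_gt0.
  have := right_half_plane_bound (z0 := z) r0 (fun w _ => conj (df w) (Rf w)).
  move=> le; apply: le_trans le _; rewrite add0r le_eqVlt; apply/orP; left; apply/eqP.
  by field; rewrite !gt_eqF ?Rf.
move=> z w; have := @constant_on_segment f w (z - w) (fun t _ => f0 _).
by rewrite addrC subrK.
Qed.

Definition half_plane_map f :=
  forall z, 0 < complex.Re z -> differentiable f z /\ 0 < complex.Re (f z).

(** A weak form of the Schwarz-Pick lemma, where [K] depends on [z] and [w] but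
    not on [f]. Along the segment from [z] to [w], [right_half_plane_bound] bounds
    the derivative of [f] by a multiple of its real part [X], so [X] grows at most
    exponentially, by Gronwall's argument. *)
Lemma half_plane_displacement z w : 0 < complex.Re z -> 0 < complex.Re w ->
  exists K : R, forall f, half_plane_map f ->
    normc (f w - f z) <= K * complex.Re (f z).
Proof.
move=> z0 w0; pose m := Num.min (complex.Re z) (complex.Re w).
have m0 : 0 < m by rewrite lt_min z0.
pose v := w - z; pose c := 8 * normc v / m.
exists (8 * expR c / m * normc v) => f fH.
have Rg (t : R) : 0 <= t <= 1 -> m <= complex.Re (z + t%:C * v).
  move=> /andP[t0 t1]; rewrite Re_add Re_mul /= mul0r subr0 /v Re_add Re_opp.
  have mz : m <= complex.Re z by rewrite ge_min lexx.
  have mw : m <= complex.Re w by rewrite ge_min lexx orbT.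
  nra.
have Hg (t : R) : 0 <= t <= 1 -> differentiable f (z + t%:C * v) /\
    normc (f^`()%classic (z + t%:C * v)) <= 8 * complex.Re (f (z + t%:C * v)) / m.
  move=> t01; have mR := Rg t t01; split.
    by case: (fH (z + t%:C * v)) => //; exact: lt_le_trans mR.
  apply: right_half_plane_bound => // u um; apply: fH.
  have := le_lt_trans (Re_le_normc _) um; rewrite ltr_norml Re_add Re_opp => /andP[].
  lra.
have dg (t : R) (t01 : 0 <= t <= 1) :=
  has_cderiv_line (differentiable_has_cderiv (Hg t t01).1).
pose X (t : R) := complex.Re (f (z + t%:C * v)).
have X0 (t : R) : 0 <= t <= 1 -> 0 < X t.
  move=> t01; case: (fH (z + t%:C * v)) => //; exact: lt_le_trans (Rg t t01).
(* [X t * expR (- c * t)] is nonincreasing. *)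
have XE (t : R) : 0 <= t <= 1 -> X t <= expR c * X 0.
  move=> t01; pose Y s := X s * expR (- c * s).
  have dY (s : R) : 0 <= s <= 1 -> is_derive s 1 Y
     ((complex.Re (f^`()%classic (z + s%:C * v) * v) - c * X s) * expR (- c * s)).
    move=> s01; have [dX _] := dg s s01.
    have dE : is_derive s 1 (fun s : R => expR (- c * s)) (- c * expR (- c * s)).
      have d1 : is_derive s 1 (fun s : R => - c * s) (- c).
        have h := is_deriveZ (- c) (is_derive_id s (1 : R)).
        by apply: (is_derive_eq h); exact: mulr1.
      have h := is_derive1_comp (is_derive_expR (- c * s)) d1.
      apply: (is_derive_eq h). exact: mulrC.
    have := is_deriveM dX dE; rewrite -/X => h; apply: is_derive_eq h _.
    by rewrite -![_ *: _]/(_ * _); ring.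
  have [t0 t1] := andP t01.
  have [s|s|s] := @MVT_segment R Y (fun s =>
    (complex.Re (f^`()%classic (z + s%:C * v) * v) - c * X s) * expR (- c * s)) 0 t t0.
  - rewrite in_itv /= => /andP[s0 s1]; apply: dY; apply/andP; split; lra.
  - apply: (@derivable_within_continuous R R) => y; rewrite in_itv /= => /andP[y0 y1].
    by case: (dY y) => //; apply/andP; split; lra.
  rewrite in_itv /= => /andP[s0 s1]; rewrite subr0 => YE.
  have s01 : 0 <= s <= 1 by apply/andP; split; lra.
  have : Y t - Y 0 <= 0.
    rewrite YE mulr_le0_ge0 // mulr_le0_ge0 ?expR_ge0 // subr_le0.
    apply: le_trans (ler_norm _) _; apply: le_trans (Re_le_normc _) _.
    rewrite normcM; apply: le_trans (ler_wpM2r (normc_ge0 v) (Hg s s01).2) _.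
    by rewrite /c -/(X s) le_eqVlt; apply/orP; left; apply/eqP; ring.
  rewrite subr_le0 /Y mulr0 expR0 mulr1 mulNr expRN ler_pdivrMr ?expR_gt0 //.
  move=> le; apply: le_trans le _; rewrite mulrC ler_wpM2r //.
    by apply/ltW/X0; rewrite lexx ler01.
  rewrite ler_expR; have c0 : 0 <= c.
    by rewrite /c divr_ge0 ?mulr_ge0 ?normc_ge0 // ltW.
  nra.
have := @has_rderiv_bound R (fun t => f (z + t%:C * v))
   (fun t => f^`()%classic (z + t%:C * v) * v) 0 1
   (8 * (expR c * X 0) / m * normc v) ler01 dg.
rewrite /X mul1r mul0r addr0 subr0 mulr1 {1}/v [z + _]addrC subrK => le.
have -> : 8 * expR c / m * normc v * complex.Re (f z) =
  8 * (expR c * complex.Re (f z)) / m * normc v by ring.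
apply: le => t t01; rewrite normcM ler_wpM2r ?normc_ge0 //.
apply: le_trans (Hg t t01).2 _.
rewrite ler_pM2r ?invr_gt0 // ler_pM2l //.
by have := XE t t01; rewrite /X mul0r addr0.
Qed.

End HalfPlane.

(** * Nilpotent groups of maps of the half-plane *)

Section Displacement.
Context {R : realType}.
Local Notation C := R[i].

(** If [f] moves points by at most a multiple of the distance to the boundary,
    then [f - id] vanishes on the boundary, which the maximum principle turns into
    vanishing inside. Infinity is dealt with by the Cayley map [cay] from the
    unit disc: the function [g] below is bounded by [K * (1 - normc u ^+ 2)], and
    [g 0 = f 1 - 1]. *)
Lemma bounded_displacement_fix1 (f : C -> C) (K : R) : half_plane_map f ->
  (forall z, 0 < complex.Re z -> normc (f z - z) <= K * complex.Re z) -> f 1 = 1.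
Proof.
move=> fH fK; apply/eqP; rewrite -subr_eq0; apply/negP => /negP.
rewrite -normc_gt0; set eta := normc _ => eta0.
have K0 : 0 < K by have := fK 1 ltr01; rewrite mulr1; apply: lt_le_trans.
pose cay (u : C) : C := (1 + u) * (1 - u)^-1.
pose g (u : C) : C := (f (cay u) - cay u) * ((1 - u) * (1 - u)).
have ne1 u : normc u < 1 -> 1 - u != 0.
  by move=> u1; rewrite subr_eq0; apply: contraTneq u1 => <-; rewrite normc1 ltxx.
have cayR u : normc u < 1 ->
    complex.Re (cay u) * normc (1 - u) ^+ 2 = 1 - normc u ^+ 2.
  move=> /ne1; rewrite -normc_gt0 => n0.
  have := sqr_normcE (1 - u); have := sqr_normcE u.
  move: n0; rewrite /cay; case: u => x y.
  rewrite Re_mul !ReImE /= => n0 -> E; rewrite E.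
  have D0 : (1 - x) ^+ 2 + (0 - y) ^+ 2 != 0 by rewrite -E expf_neq0 // gt_eqF.
  by move: D0; rewrite sub0r => D0; field.
have cay0 u : normc u < 1 -> 0 < complex.Re (cay u).
  move=> u1; have n0 : 0 < normc (1 - u) ^+ 2 by rewrite exprn_gt0 // normc_gt0 ne1.
  rewrite -(pmulr_lgt0 _ n0) cayR // subr_gt0.
  by rewrite expr_lt1 // normc_ge0.
have dcay u : normc u < 1 -> differentiable cay u.
  move=> u1; apply: differentiableM.
    exact: differentiable_shift.
  apply: differentiableV; last exact: ne1.
  apply: differentiableB; first exact: differentiable_cst.
  exact: (@ex_diff _ _ _ _ _ _ _ (is_diff_id u)).
have d1 u : differentiable (fun u : C => 1 - u) u.
  apply: differentiableB; first exact: differentiable_cst.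
  exact: (@ex_diff _ _ _ _ _ _ _ (is_diff_id u)).
have dg u : normc u < 1 -> differentiable g u.
  move=> u1; apply: differentiableM; last by apply: differentiableM; exact: d1.
  apply: differentiableB; last exact: dcay.
  by apply: differentiable_compC; [exact: dcay | case: (fH _ (cay0 u u1))].
have gb u : normc u < 1 -> normc (g u) <= K * (1 - normc u ^+ 2).
  move=> u1; rewrite normcM normcM -expr2 -(cayR u u1) mulrA.
  by rewrite ler_wpM2r ?sqr_ge0 // fK // cay0.
(* The circle of radius [1 - t] gives a bound below [eta]. *)
pose t := Num.min (1 / 2) (eta / (4 * K)).
have t0 : 0 < t by rewrite lt_min !divr_gt0 // mulr_gt0.
have t1 : t <= 1 / 2 by rewrite ge_min lexx.
have t2 : t <= eta / (4 * K) by rewrite ge_min lexx orbT.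
have rho : 0 < 1 - t < 1 by apply/andP; split; lra.
have n01 : normc (0 : C) < 1 by rewrite normc0.
have := @center_le_circle R g 1 (1 - t) (K * (1 - (1 - t) ^+ 2)) rho
  (fun e e0 => differentiable_continuousC (dg 0 n01) e0) _ _.
have -> : g 0 = f 1 - 1 by rewrite /g /cay !subr0 addr0 invr1 !mulr1.
rewrite -/eta => /(_ (fun z zr => dg z (andP zr).2)) H.
have {H} : eta <= K * (1 - (1 - t) ^+ 2).
  apply: H => z zt; have := gb z; rewrite zt; apply.
  by case/andP: rho.
move: t2; rewrite ler_pdivlMr ?mulr_gt0 // => t2.
nra.
Qed.

End Displacement.

Section Group.
Context {R : realType}.
Local Notation C := R[i].
Variables (G : groupType) (phi : G -> C -> C).
Hypothesis phi_map : forall g, half_plane_map (phi g).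
Hypothesis phiM : forall g h z, 0 < complex.Re z -> phi (g * h)%g z = phi g (phi h z).
Hypothesis phi_trans : forall z w, 0 < complex.Re z -> 0 < complex.Re w ->
  exists g, phi g z = w.

(** Let [g] take 1 to [z]. Then [phi x z] and [z] are the images under [phi g] of
    [phi x 1] and 1, two points that do not depend on [z], so
    [half_plane_displacement] bounds the displacement of [phi x] at [z] by a
    constant multiple of [Re z]. Hence
    [phi x] fixes 1, and by commutation the whole orbit of 1. *)
Lemma commuting_trivial x :
  (forall g z, 0 < complex.Re z -> phi x (phi g z) = phi g (phi x z)) ->
  forall z, 0 < complex.Re z -> phi x z = z.
Proof.
move=> xC; have R1 : 0 < complex.Re (1 : C) := ltr01.
have [_ Rx1] := phi_map x R1.
have [K KP] := half_plane_displacement R1 Rx1.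
have fix1 : phi x 1 = 1.
  apply: (@bounded_displacement_fix1 R _ K (phi_map x)) => z z0.
  by have [g <-] := phi_trans R1 z0; rewrite xC //; exact: KP.
by move=> z z0; have [g <-] := phi_trans R1 z0; rewrite xC // fix1.
Qed.

(** If all commutators of [x] act trivially, then [x] commutes with the action,
    hence acts trivially. Going up the lower central series from its trivial end,
    the whole group acts trivially, so it is not transitive. *)
Lemma transitive_not_nilpotent : ~ nilpotent_group G.
Proof.
move=> [k Gk].
have phi1 z : 0 < complex.Re z -> phi 1%g z = z.
  move=> z0; have [g <-] := phi_trans (ltr01 : 0 < complex.Re (1 : C)) z0.
  by rewrite -phiM // mul1g.
have triv j : (j <= k)%N -> forall x, @lower_central G (k - j)%N x ->
    forall z, 0 < complex.Re z -> phi x z = z.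
  elim: j => [_ x|j IH jk x Lx].
    by rewrite subn0 Gk => -> z z0; exact: phi1.
  apply: commuting_trivial => g z z0.
  have c1 : phi [~ x, g]%g z = z.
    apply: IH => //; first exact: ltnW.
    by rewrite -(subnSK jk) /=; apply: sub_gen_smallest; exists x, g.
  have E : (x * g = g * x * [~ x, g])%g by exact: commgC.
  by rewrite -phiM // E phiM // c1 phiM.
have := @triv k (leqnn k); rewrite subnn => trivG.
have R1 : 0 < complex.Re (1 : C) := ltr01.
have R2 : 0 < complex.Re ((2 : R)%:C : C) := ltr0Sn R 1.
have [g] := phi_trans R1 R2; rewrite trivG // => /(congr1 (@complex.Re R)) /=.
lra.
Qed.

End Group.

(** * Restriction of holomorphic functions to complex lines *)

Section Lines.
Context {R : realType} {m : nat}.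
Local Notation C := R[i].
Local Notation V := ('rV[C]_m).
Implicit Types (f : V -> C) (p v : V).

Lemma is_diff_line p v (z0 : C) :
  is_diff z0 (fun z : C => p + z *: v) (fun z : C => z *: v).
Proof.
have h := @is_diffD C C V (cst p) ( *:%R^~ v) (cst 0) ( *:%R^~ v) z0
  (@is_diff_cst C C V p z0) (@is_diff_scalel C V z0 v).
have E : (cst 0 : C -> V) + *:%R^~ v = (fun z : C => z *: v).
  by apply/funext => z; rewrite /= fctE add0r.
by rewrite E in h.
Qed.

Lemma has_cderiv_complex_line f p v (z0 : C) : differentiable f (p + z0 *: v) ->
  has_cderiv (fun z => f (p + z *: v)) z0 ('d f (p + z0 *: v) v).
Proof.
move=> df; have dl := is_diff_line p v z0.
have dl' := @ex_diff _ _ _ _ _ _ _ dl.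
have dc := @differentiable_comp C C V C (fun z : C => p + z *: v) f z0 dl' df.
have := differentiable_has_cderiv dc; congr has_cderiv.
rewrite (derive1E' dc) (@diff_comp C C V C (fun z : C => p + z *: v) f z0 dl' df) /=.
by rewrite diff_val scale1r.
Qed.

Lemma diff_scale f p (a : C) v : 'd f p (a *: v) = a * 'd f p v.
Proof. exact (linearZ_LR ('d f p) a v). Qed.

Lemma diff_add f p u v : 'd f p (u + v) = 'd f p u + 'd f p v.
Proof. exact (raddfD ('d f p) u v). Qed.

Lemma open_line (D : set V) p v : open D -> D p ->
  exists2 d : R, 0 < d & forall z : C, normc z < d -> D (p + z *: v).
Proof.
move=> oD Dp; have lc : {for (0 : C), continuous (fun z : C => p + z *: v)}.
  exact: (@differentiable_continuous C C V _ _
    (@ex_diff _ _ _ _ _ _ _ (is_diff_line p v 0))).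
have : nbhs (p + (0 : C) *: v) D by rewrite scale0r addr0; exact: open_nbhs_nbhs.
move=> /lc /(@nbhs_normcP R 0) [d d0 dP]; exists d => // z zd.
by apply: dP; rewrite subr0.
Qed.

End Lines.

(** * Holomorphic functions on the two domains *)

Lemma shift_real (K : pzRingType) (W : lmodType K) (y e c l : W) (x t : K) :
  y + t *: e + 1 *: (c + (x + t) *: l) = y + 1 *: (c + x *: l) + t *: (e + l).
Proof. by rewrite !scale1r scalerDl [c + _]addrA addrACA scalerDr. Qed.

Lemma real_complexD (R : realType) (x t : R) : (x + t)%:C = x%:C + t%:C :> R[i].
Proof. exact: rmorphD. Qed.

Section Domain.
Context {R : realType} {n : nat}.
Hypothesis n3 : (3 <= n)%N.
Local Notation C := R[i].
Local Notation V := ('rV[C]_n.+1).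
Implicit Types (z w v : V) (f : V -> C).

(** Numbered from 0, whereas [xcoord] numbers coordinates from 1. *)
Definition coordv k : V := delta_mx ord0 (inord k).

Lemma xcoord_add z w k : xcoord (z + w) k = xcoord z k + xcoord w k.
Proof. by rewrite /xcoord mxE Re_add. Qed.

Lemma xcoord_scale (a : C) j k : (j <= n)%N -> (0 < k <= n.+1)%N ->
  xcoord (a *: coordv j) k = if k == j.+1 then complex.Re a else 0.
Proof.
move=> jn /andP[k0 kn]; rewrite /xcoord !mxE eqxx /= -val_eqE /= !inordK //.
  by rewrite -{2}(prednK k0) eqSS; case: eqP => _; rewrite ?mulr1 ?mulr0.
by rewrite prednK.
Qed.

Lemma tube_cubic_last z (a : C) : tube_cubic (z + a *: coordv n) = tube_cubic z.
Proof.
have x k : (0 < k < n.+1)%N -> xcoord (z + a *: coordv n) k = xcoord z k.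
  move=> /andP[k0 kn]; rewrite xcoord_add xcoord_scale ?k0 ?(ltnW kn) //.
  by rewrite ltn_eqF ?addr0.
have n1 : (1 < n.+1)%N by rewrite ltnS (leq_trans _ n3).
have n2 : (2 < n.+1)%N by rewrite ltnS (leq_trans _ n3).
rewrite /tube_cubic !x ?n1 ?n2 //; congr (_ + _ * _).
apply: eq_big_nat => j /andP[j3 jn]; rewrite x // jn andbT.
exact: leq_trans j3.
Qed.

Lemma tube_cubic_second z (a : C) :
  tube_cubic (z + a *: coordv 1) = tube_cubic z + xcoord z 1 * complex.Re a.
Proof.
have n1 : (1 <= n)%N by apply: leq_trans n3.
have x k : (0 < k <= n.+1)%N -> xcoord (z + a *: coordv 1) k =
    xcoord z k + (if k == 2 then complex.Re a else 0).
  by move=> kn; rewrite xcoord_add xcoord_scale.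
have E : \sum_(3 <= j < n.+1) xcoord (z + a *: coordv 1) j ^+ 2 =
         \sum_(3 <= j < n.+1) xcoord z j ^+ 2.
  apply: eq_big_nat => j /andP[j3 jn]; rewrite x ?(ltnW jn) ?andbT ?(leq_trans _ j3) //.
  by rewrite gtn_eqF // addr0.
rewrite /tube_cubic E !x //=.
by rewrite addr0; ring.
Qed.

(** The two sides of the hypersurface, [C_gt] for [s = 1] and [C_lt] for
    [s = -1]. *)
Definition side (s : R) : set V :=
  [set z | 0 < s * (xcoord z n.+1 - tube_cubic z) /\ 0 < xcoord z 1].

Lemma C_gt_side : C_gt R n = side 1.
Proof.
by apply/seteqP; split=> z [z1 z2]; split=> //; move: z1; rewrite mul1r subr_gt0.
Qed.

Lemma C_lt_side : C_lt R n = side (-1).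
Proof.
by apply/seteqP; split=> z [z1 z2]; split=> //; move: z1;
  rewrite mulN1r opprB subr_gt0.
Qed.

Lemma xcoord_last z (a : C) :
  xcoord (z + a *: coordv n) n.+1 = xcoord z n.+1 + complex.Re a.
Proof. by rewrite xcoord_add xcoord_scale ?eqxx ?leqnn. Qed.

Lemma xcoord1_last z (a : C) : xcoord (z + a *: coordv n) 1 = xcoord z 1.
Proof.
by rewrite xcoord_add xcoord_scale // ltn_eqF ?addr0 // ltnS (leq_trans _ n3).
Qed.

Lemma side_last s z (a : C) : side s (z + a *: coordv n) <->
  0 < s * (xcoord z n.+1 + complex.Re a - tube_cubic z) /\ 0 < xcoord z 1.
Proof. by rewrite /side /= tube_cubic_last xcoord_last xcoord1_last. Qed.

(** With [x_1] and the other coordinates fixed, [x_{n+1} - tube_cubic] depends on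
    [x_2] and [x_{n+1}] through [x_{n+1} - x_1 x_2], hence is constant along the
    whole complex line through [z] in this direction. *)
Definition flat_direction (z : V) : V := coordv 1 + (xcoord z 1)%:C *: coordv n.

Lemma side_flat s z (a : C) : side s z -> side s (z + a *: flat_direction z).
Proof.
have n1 : (1 <= n)%N by apply: leq_trans n3.
move=> [z1 z2]; rewrite /flat_direction scalerDr scalerA addrA; apply/side_last.
rewrite tube_cubic_second xcoord_add xcoord_scale ?leqnn ?eqSS ?gtn_eqF //=;
  last by apply: leq_trans n3.
rewrite xcoord_add xcoord_scale //= addr0 Re_mul /= mulr0 subr0; split=> //.
  by move: z1; congr (0 < s * _); ring.
by rewrite addr0.
Qed.

Section FirstCoordinateOnly.
Variables (s : R) (f : V -> C).
Hypothesis s_sign : s = 1 \/ s = -1.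
Hypothesis side_open : open (side s).
Hypothesis df : forall z, side s z -> differentiable f z.
Hypothesis Rf : forall z, side s z -> 0 < complex.Re (f z).

Lemma constant_flat z (a : C) : side s z -> f (z + a *: flat_direction z) = f z.
Proof.
move=> zD; have H b : side s (z + b *: flat_direction z) by exact: side_flat.
have := @entire_right_half_plane R (fun b => f (z + b *: flat_direction z)) _ _ a 0.
rewrite scale0r addr0; apply=> b; last exact: Rf.
exact: has_cderiv_differentiable (has_cderiv_complex_line (df (H b))).
Qed.

(** The flat direction varies with [x_1] but not with [y_1]. With [y] such that
    [z = y + flat_direction y], constancy along flat lines says that [f] at
    [y + t e_1] equals [f] at [z + t (e_1 + e_{n+1})] for [t] real, and at
    [z + t e_1] for [t] imaginary. Complex linearity of the two differentials
    leaves no room for a derivative in the direction [e_{n+1}]. *)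
Lemma diff_last z : side s z -> 'd f z (coordv n) = 0 :> C.
Proof.
have n1 : (1 <= n)%N by apply: leq_trans n3.
move=> zD; pose y := z + (-1) *: flat_direction z.
have yD : side s y by exact: side_flat.
have y1 : xcoord y 1 = xcoord z 1.
  rewrite /y /flat_direction scalerDr scalerA addrA xcoord1_last xcoord_add.
  rewrite xcoord_scale //=.
  by rewrite addr0.
have yz : y + 1 *: flat_direction z = z by rewrite /y scaleN1r scale1r subrK.
pose e0 := coordv 0.
have f0 : flat_direction z = coordv 1 + (xcoord z 1)%:C *: coordv n by [].
have key (v u : V) : (forall t : R, y + t%:C *: v + 1 *: flat_direction (y + t%:C *: v)
      = z + t%:C *: u) -> 'd f y v = 'd f z u :> C.
  move=> vu; have [d d0 dP] := open_line v side_open yD.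
  have E0 p q : p + (0 : C) *: q = p :> V by rewrite scale0r addr0.
  have c1 := @has_cderiv_complex_line R _ f y v 0.
  have c2 := @has_cderiv_complex_line R _ f z u 0.
  rewrite E0 in c1; rewrite E0 in c2.
  apply: (real_cderiv_unique (c1 (df yD)) (c2 (df zD))).
  exists d => // t td; rewrite add0r -vu constant_flat //.
  by apply: dP; rewrite normc_real.
have flat0 (a : C) : flat_direction (y + a *: e0) =
    coordv 1 + (xcoord z 1 + complex.Re a)%:C *: coordv n.
  by rewrite /flat_direction xcoord_add y1 (xcoord_scale _ (leq0n n)).
have k1 : 'd f y e0 = 'd f z (e0 + coordv n) :> C.
  apply: key => t; rewrite flat0 real_complexD -[X in _ = X + _]yz f0.
  exact: shift_real.
have k2 : 'd f y ('i *: e0) = 'd f z ('i *: e0) :> C.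
  apply: key => t; rewrite scalerA flat0.
  have -> : complex.Re (t%:C * 'i) = 0 by rewrite Re_mul /= mulr0 mul0r subrr.
  rewrite addr0 -[X in _ = X + _]yz f0.
  exact: addrAC.
have i0 : ('i : C) != 0 by rewrite eq_complex /= oner_eq0 andbF.
have yz0 := mulfI i0 (etrans (esym (diff_scale f y 'i e0))
  (etrans k2 (diff_scale f z 'i e0))).
have := etrans (esym yz0) (etrans k1 (diff_add f z e0 (coordv n))).
by rewrite -[X in X = _]addr0 => /addrI.
Qed.

Lemma constant_last z (a : C) : side s z -> side s (z + a *: coordv n) ->
  f (z + a *: coordv n) = f z.
Proof.
move=> zD aD.
have tD (t : R) : 0 <= t <= 1 -> side s (z + (t%:C * a) *: coordv n).
  move=> /andP[t0 t1]; apply/side_last; case/side_last: aD => a1 _.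
  case: zD => z1 z2; split=> //; rewrite Re_mul /= mul0r subr0.
  (* A convex combination of two positive numbers. *)
  have -> : s * (xcoord z n.+1 + t * complex.Re a - tube_cubic z) =
    (1 - t) * (s * (xcoord z n.+1 - tube_cubic z)) +
    t * (s * (xcoord z n.+1 + complex.Re a - tube_cubic z)) by ring.
  have [->|t_neq0] := eqVneq t 0; first by rewrite subr0 mul1r mul0r addr0.
  apply: ltr_wpDl; first by apply: mulr_ge0; [rewrite subr_ge0 | exact: ltW].
  by apply: mulr_gt0; rewrite // lt_def t_neq0.
have flat (t : R) : 0 <= t <= 1 ->
    has_cderiv (fun b => f (z + b *: coordv n)) (0 + t%:C * a) 0.
  move=> t01; rewrite add0r -(diff_last (tD t t01)).
  exact: has_cderiv_complex_line (df (tD t t01)).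
by have := constant_on_segment flat; rewrite add0r scale0r addr0.
Qed.

(** Since [f] does not depend on the last coordinate, that coordinate can be
    adjusted along the complex line from [z] to [w] so as to stay in the domain.
    This makes [f] an entire function [h] on that line, to which Liouville's
    theorem applies. The adjustment [lift] is not holomorphic, but near each
    point it can be replaced by a constant. *)
Lemma depends_on_first z w : side s z -> side s w ->
  z ord0 (inord 0) = w ord0 (inord 0) -> f z = f w.
Proof.
move=> zD wD zw; pose line (b : C) : V := z + b *: (w - z).
pose lift (v : V) : C := (tube_cubic v + s - xcoord v n.+1)%:C.
have lineR b : 0 < xcoord (line b) 1.
  by rewrite /xcoord /line !mxE zw subrr mulr0 addr0; case: wD.
have liftD b : side s (line b + lift (line b) *: coordv n).
  apply/side_last; split=> //=.
  have -> : forall x t : R, x + (t + s - x) - t = s by move=> x t; ring.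
  by case: s_sign => ->; rewrite ?mulN1r ?opprK ?mulr1.
pose h b := f (line b + lift (line b) *: coordv n).
have hz : h 0 = f z.
  have l0 : line 0 = z by rewrite /line scale0r addr0.
  by rewrite /h l0 constant_last // -{2}l0 -{1}l0.
have hw : h 1 = f w.
  have l1 : line 1 = w by rewrite /line scale1r addrC subrK.
  by rewrite /h l1 constant_last // -{2}l1 -{1}l1.
rewrite -hz -hw; apply: entire_right_half_plane => b; last exact: Rf.
pose c := lift (line b).
have Eq b' : (z + c *: coordv n) + b' *: (w - z) = line b' + c *: coordv n.
  by rewrite /line addrAC.
have Db : side s ((z + c *: coordv n) + b *: (w - z)) by rewrite Eq; exact: liftD.
have [d d0 dP] := open_line (w - z) side_open Db.
have := has_cderiv_differentiable (has_cderiv_complex_line (df Db)).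
apply: (differentiable_near d0) => b' bb'.
have := dP _ bb'; rewrite -addrA -scalerDl [b + _]addrC subrK Eq => H.
have E : line b' + c *: coordv n + (lift (line b') - c) *: coordv n =
    line b' + lift (line b') *: coordv n.
  by rewrite -addrA -scalerDl [c + _]addrC subrK.
have := constant_last (a := lift (line b') - c) H; rewrite E => /(_ (liftD b')) hb.
by rewrite -hb.
Qed.

End FirstCoordinateOnly.
End Domain.

(** * The action on the first coordinate *)

Section Homogeneity.
Context {R : realType} {n : nat}.
Hypothesis n3 : (3 <= n)%N.
Local Notation C := R[i].
Local Notation V := ('rV[C]_n.+1).

Definition first (z : V) : C := z ord0 (inord 0).

Lemma first_coordv0 (a : C) : first (a *: coordv 0) = a.
Proof. by rewrite /first !mxE !eqxx mulr1. Qed.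

Lemma first_last (z : V) (a : C) : first (z + a *: coordv n) = first z.
Proof.
rewrite /first !mxE eqxx /= -val_eqE /= !inordK // ltn_eqF ?mulr0 ?addr0 //.
by apply: leq_trans n3.
Qed.

Lemma axis_coord (a : C) : [/\ xcoord (a *: coordv 0 : V) n.+1 = 0,
  tube_cubic (a *: coordv 0 : V) = 0 & xcoord (a *: coordv 0 : V) 1 = complex.Re a].
Proof.
have n0 : (0 < n)%N by apply: leq_trans n3.
have x k : (1 < k <= n.+1)%N -> xcoord (a *: coordv 0 : V) k = 0.
  by move=> /andP[k1 kn]; rewrite xcoord_scale ?gtn_eqF // kn ltnW.
split; first by rewrite x ?leqnn ?ltnS ?n0.
  rewrite /tube_cubic [xcoord _ 2]x ?ltnS // mulr0 add0r.
  rewrite big_nat big1 ?mulr0 // => j /andP[j3 jn].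
  by rewrite x ?expr0n // (ltnW jn) (leq_trans _ j3).
by rewrite xcoord_scale.
Qed.

Lemma axis_boundary (a : C) : 0 < complex.Re a -> Gamma_tilde R n (a *: coordv 0).
Proof. by move=> a0; have [x1 x2 x3] := axis_coord a; rewrite /Gamma_tilde /= x1 x2 x3. Qed.

Lemma axis_side (s : R) (a b : C) : 0 < complex.Re a -> 0 < s * complex.Re b ->
  side s (a *: coordv 0 + b *: coordv n : V).
Proof.
move=> a0 b0; apply/(side_last n3); have [-> -> ->] := axis_coord a.
by rewrite add0r subr0.
Qed.

Lemma differentiable_first (f : V -> V) z : differentiable f z ->
  differentiable (fun z => first (f z)) z.
Proof.
move=> df; exact (@differentiable_comp C V V C f first z df
  (@differentiable_coord C 1 n.+1 (f z) ord0 (inord 0))).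
Qed.

(** By [depends_on_first] the first coordinate of [act g z] is a function [phi g]
    of the first coordinate of [z], and [phi] is an action by holomorphic maps of
    the half-plane. It also describes the first coordinate of [ext g] on the
    hypersurface, by continuity along the last coordinate; so [phi] is transitive
    because the action on the hypersurface is. *)
Theorem side_not_homogeneous (s : R) : s = 1 \/ s = -1 ->
  ~ boundary_nilpotently_homogeneous (side s) (Gamma_tilde R n).
Proof.
move=> s_sign [G [act [ext [nilG [bih actM _ _] exta extS trans]]]].
have ss : 0 < s * s by case: s_sign => ->; rewrite ?mulr1 ?mulrNN ?mulr1 ltr01.
have Dopen : open (side s : set V) by have [? [[]]] := bih 1%g.
have actD g z : side s z -> side s (act g z).
  by have [? [_ _ H _]] := bih g; move=> /H[].
have dF g z : side s z -> differentiable (fun z => first (act g z)) z.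
  by move=> zD; apply: differentiable_first; have [? [[_ H] _ _ _]] := bih g; exact: H.
have RF g z : side s z -> 0 < complex.Re (first (act g z)).
  by move=> /(actD g)[].
pose sec (a : C) : V := s%:C *: coordv n + a *: coordv 0.
have secD a : 0 < complex.Re a -> side s (sec a).
  by move=> a0; rewrite /sec addrC; exact: axis_side.
have first_sec a : first (sec a) = a.
  by rewrite /sec addrC first_last first_coordv0.
pose phi g a := first (act g (sec a)).
have key g z : side s z -> first (act g z) = phi g (first z).
  move=> zD; apply: (depends_on_first n3 s_sign Dopen (dF g) (RF g) zD).
    by apply: secD; case: zD.
  by rewrite -/(first _) -/(first _) first_sec.
apply: (@transitive_not_nilpotent R G phi) nilG.
- move=> g a a0; split; last exact/RF/secD.
  exact: has_cderiv_differentiable (has_cderiv_complex_line (dF g _ (secD a a0))).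
- move=> g h a a0; rewrite {1}/phi actM; last exact: secD.
  by rewrite key //; exact/actD/secD.
move=> a b a0 b0; have [g gab] := trans _ _ (axis_boundary a0) (axis_boundary b0).
exists g; have [U [SU [Uopen dext] extE]] := exta g.
have Uz : U (a *: coordv 0) by exact/SU/axis_boundary.
apply/eqP; rewrite -subr_eq0; apply/negP => /negP; rewrite -normc_gt0 => eta0.
pose h (c : C) := first (ext g (a *: coordv 0 + c *: coordv n)).
have U0 : U (a *: coordv 0 + (0 : C) *: coordv n) by rewrite scale0r addr0.
(* The points with parameter [s * t], [t] positive and real, lie in the domain,
   where [h] is constantly [phi g a], whereas [h 0] is [b]. *)
have dh : differentiable h 0.
  exact: has_cderiv_differentiable
    (has_cderiv_complex_line (differentiable_first (dext _ U0))).
have h0 : h 0 = b by rewrite /h scale0r addr0 gab first_coordv0.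
have [d d0 dP] := differentiable_continuousC dh eta0.
have [r r0 rP] := open_line (coordv n) Uopen Uz.
pose t := Num.min d r / 2.
have m0 : 0 < Num.min d r by rewrite lt_min d0.
have t0 : 0 < t by rewrite divr_gt0.
have tm : t < Num.min d r by rewrite /t; lra.
move: tm; rewrite lt_min => /andP[td tr].
have nst : normc (s * t)%:C = t.
  rewrite normc_real normrM; case: s_sign => ->;
  by rewrite ?normrN normr1 mul1r gtr0_norm.
have tD : side s (a *: coordv 0 + (s * t)%:C *: coordv n : V).
  by apply: axis_side => //=; rewrite mulrA mulr_gt0.
have := dP (s * t)%:C; rewrite subr0 nst => /(_ td).
rewrite h0 /h extE //; last by apply: rP; rewrite nst.
by rewrite key // first_last first_coordv0 ltxx.
Qed.

End Homogeneity.

Theorem theorem4 (R : realType) (n : nat)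
    (nil_ball : forall m : nat, set 'rV[R[i]]_m -> Prop) :
  (3 <= n)%N ->
  (* Penney's property of nil-balls, for the two domains *)
  (equivalent_to_nil_ball nil_ball (C_gt R n) ->
     boundary_nilpotently_homogeneous (C_gt R n) (Gamma_tilde R n)) ->
  (equivalent_to_nil_ball nil_ball (C_lt R n) ->
     boundary_nilpotently_homogeneous (C_lt R n) (Gamma_tilde R n)) ->
  ~ equivalent_to_nil_ball nil_ball (C_gt R n) /\
  ~ equivalent_to_nil_ball nil_ball (C_lt R n).
Proof.
move=> n3 gt lt; split.
  move=> /gt; rewrite C_gt_side.
  by apply: (side_not_homogeneous n3); left.
move=> /lt; rewrite C_lt_side.
by apply: (side_not_homogeneous n3); right.
Qed.
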